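(* The irreducible $\widehat{\mathfrak{sl}}_2'$-module $L_{(0,1)}$ of highest weight $(0,1)$ has a basis consisting of the semi-infinite monomials $$e_{i_1}\,e_{i_2}\,e_{i_3}\cdots$$ indexed by all integer sequences $(i_k)_{k\ge 1}$ such that 1. $i_1<i_2<i_3<\cdots$; 2. $i_{k+1}-i_k\ge 2$ for all $k\geq 1$; 3. $i_k\equiv 1 \pmod 2$ for all sufficiently large $k$; 4. $i_{k+1}-i_k=2$ for all sufficiently large $k$. Here the semi-infinite monomial is regarded as a vector of $L_{(0,1)}$ via the identification $|j\sqrt2\rangle = e_{-2j+1}\,e_{-2j+3}\,e_{-2j+5}\cdots$ $(j\in\mathbb{Z})$; that is, if $N\ge 0$ and $j\in\mathbb{Z}$ are such that $i_{N+r}=-2j+2r-1$ for all $r\ge 1$, then $e_{i_1}e_{i_2}e_{i_3}\cdots$ denotes the vector $e_{i_1}e_{i_2}\cdots e_{i_N}|j\sqrt2\rangle$.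
   Context: The Lie algebra $\widehat{\mathfrak{sl}}_2'=\mathfrak{sl}_2\otimes\mathbb{C}[t,t^{-1}]\oplus\mathbb{C}K$ has basis $e_n,f_n,h_n$ ($n\in\mathbb{Z}$), $K$, and brackets $[e_n,e_m]=[f_n,f_m]=0$, $[e_n,f_m]=h_{n+m}+n\delta_{n,-m}K$, $[h_n,e_m]=2e_{n+m}$, $[h_n,f_m]=-2f_{n+m}$, $[h_n,h_m]=2n\delta_{n,-m}K$, $K$ central. Put $\hat{\mathfrak n}_+=\langle e_0\rangle+\sum_{k>0}t^k\mathfrak{sl}_2$. The module $L_{(l,k)}$ is the irreducible module with cyclic vector $v$ such that $\hat{\mathfrak n}_+v=0$, $h_0v=lv$, $Kv=kv$. Realization of $L_{(0,1)}$: let $a_n$ ($n\in\mathbb{Z}$) satisfy $[a_n,a_m]=n\delta_{n+m,0}$, and let $F_\lambda$ be the bosonic Fock module generated by $|\lambda\rangle$ with $a_n|\lambda\rangle=0$ for $n>0$ and $a_0|\lambda\rangle=\lambda|\lambda\rangle$. Then $L_{(0,1)}=\bigoplus_{m\in\mathbb{Z}}F_{m\sqrt2}$, with $K=1$ and with currents $x(z)=\sum_n x_nz^{-n-1}$ ($x=e,f,h$) acting by $e(z)={:}\exp(\sqrt2\varphi(z)){:}$, $f(z)={:}\exp(-\sqrt2\varphi(z)){:}$, $h(z)=\sqrt2\,\partial\varphi(z)$, where $\varphi(z)=q+a_0\log z+\sum_{n\ne0}\frac{a_n}{-n}z^{-n}$, $[a_0,q]=1$, $q$ commutes with $a_n$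 for $n\neq 0$, and $\exp(\pm\sqrt2 q)|\lambda\rangle=|\lambda\pm\sqrt2\rangle$. Normal ordering puts $q$ and $a_{n}$, $n<0$, to the left of $a_n$, $n\ge0$. The highest weight vector is $|0\rangle$. With these normalizations $e_{-2j-1}|j\sqrt2\rangle=|(j+1)\sqrt2\rangle$, so the vector attached to a semi-infinite monomial does not depend on the choice of $N$. *)

(* Defs.v *)
From HB Require Import structures.
From mathcomp Require Import all_boot all_order all_algebra.
From mathcomp Require Import finmap multiset monalg.
From mathcomp Require Import complex.
From mathcomp Require Import boolp classical_sets reals.

Set Implicit Arguments.
Unset Strict Implicit.
Unset Printing Implicit Defensive.

Import Order.TTheory GRing.Theory Num.Theory.
Local Open Scope mset_scope.
Local Open Scope ring_scope.

(** * Modules over the affine Lie algebra [sl2^' = sl2 (x) C[t,t^-1] (+) C K]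

    The Lie algebra is given by its basis [e_n], [f_n], [h_n], [K], so an action
    on [V] is a family of operators, and it is a module structure when these
    operators are linear and satisfy the bracket relations of the basis. *)

Record affine_ops (V : Type) := AffineOps {
  act_e : int -> V -> V;
  act_f : int -> V -> V;
  act_h : int -> V -> V;
  act_K : V -> V
}.

Section AffineModules.
Context {C : fieldType} {V : lmodType C}.
Implicit Types (rho : affine_ops V) (W : V -> Prop).

Definition commutator (X Y : V -> V) (v : V) : V := X (Y v) - Y (X v).

Record is_affine_module rho : Prop := {
  e_linear : forall n, linear (act_e rho n);
  f_linear : forall n, linear (act_f rho n);
  h_linear : forall n, linear (act_h rho n);
  K_linear : linear (act_K rho);
  bracket_ee : forall n m v, commutator (act_e rho n) (act_e rho m) v = 0;
  bracket_ff : forall n m v, commutator (act_f rho n) (act_f rho m) v = 0;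
  bracket_ef : forall n m v, commutator (act_e rho n) (act_f rho m) v
     = act_h rho (n + m) v + (if n == - m then n else 0)%:~R *: act_K rho v;
  bracket_he : forall n m v, commutator (act_h rho n) (act_e rho m) v
     = 2%:R *: act_e rho (n + m) v;
  bracket_hf : forall n m v, commutator (act_h rho n) (act_f rho m) v
     = - (2%:R *: act_f rho (n + m) v);
  bracket_hh : forall n m v, commutator (act_h rho n) (act_h rho m) v
     = (if n == - m then 2%:R * n%:~R else 0) *: act_K rho v;
  bracket_Ke : forall n v, commutator (act_K rho) (act_e rho n) v = 0;
  bracket_Kf : forall n v, commutator (act_K rho) (act_f rho n) v = 0;
  bracket_Kh : forall n v, commutator (act_K rho) (act_h rho n) v = 0
}.

Record is_submodule rho W : Prop := {
  sub_zero : W 0;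
  sub_lin : forall (c : C) u v, W u -> W v -> W (c *: u + v);
  sub_e : forall n v, W v -> W (act_e rho n v);
  sub_f : forall n v, W v -> W (act_f rho n v);
  sub_h : forall n v, W v -> W (act_h rho n v);
  sub_K : forall v, W v -> W (act_K rho v)
}.

Definition is_irreducible rho : Prop :=
  (exists v : V, v <> 0) /\
  forall W, is_submodule rho W -> (forall v, W v -> v = 0) \/ (forall v, W v).

Definition is_cyclic_vector rho (v : V) : Prop :=
  forall W, is_submodule rho W -> W v -> forall u, W u.

(** [n_+ v = 0] for [n_+ = <e_0> + sum_(k > 0) t^k sl2]. *)
Definition killed_by_nplus rho (v : V) : Prop :=
  act_e rho 0 v = 0 /\
  forall k : int, 0 < k ->
    [/\ act_e rho k v = 0, act_f rho k v = 0 & act_h rho k v = 0].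

(** [V] with the action [rho] is the module [L_(l,k)], with highest weight
    vector [v]. *)
Record is_L rho (l k : C) (v : V) : Prop := {
  L_module : is_affine_module rho;
  L_irreducible : is_irreducible rho;
  L_cyclic : is_cyclic_vector rho v;
  L_nplus : killed_by_nplus rho v;
  L_weight : act_h rho 0 v = l *: v;
  L_level : act_K rho v = k *: v
}.

(** The vectors [b i], for [i] in [D], form a basis of [V]; in particular they
    are pairwise distinct. *)
Definition is_basis (I : Type) (D : I -> Prop) (b : I -> V) : Prop :=
  (forall (n : nat) (i : 'I_n -> I) (c : 'I_n -> C),
     injective i -> (forall k, D (i k)) ->
     \sum_k c k *: b (i k) = 0 -> forall k, c k = 0) /\
  (forall v : V, exists (n : nat) (i : 'I_n -> I) (c : 'I_n -> C),
     (forall k, D (i k)) /\ v = \sum_k c k *: b (i k)).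

End AffineModules.

(** * The sum of the Fock modules [F_(m sqrt 2)], [m : int]

    [F_lambda] has the basis [a_(-n_1) ... a_(-n_r) |lambda>] indexed by the
    multisets [n_1, ..., n_r] of positive integers. As an index [(m, mu)], [mu]
    contains [n] once for each factor [a_(-(n+1))], and [m] stands for
    [lambda = m sqrt 2]. *)

Definition fock_index : choiceType := (int * {mset nat})%type.

Definition Fock (C : numClosedFieldType) : lmodType C := {malg C[fock_index]}.

Section LatticeFock.
Context {C : numClosedFieldType}.
Local Notation F := (Fock C).
Local Notation sqrt2 := (sqrtC (2%:R : C)).

Definition fock_basis (b : fock_index) : F := (<< b >> : {malg C[fock_index]}).

Definition linear_extension (g : fock_index -> F) (v : F) : F :=
  \sum_(b <- msupp (v : {malg C[fock_index]})) mcoeff b v *: g b.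

(** The vector [|m sqrt 2>]. *)
Definition ket (m : int) : F := fock_basis (m, mset0).

(** [a_n]. For [n > 0] it acts as [n d/d(a_(-n))], by [[a_n, a_(-n)] = n] and
    [a_n |lambda> = 0]. *)
Definition heis (n : int) : F -> F :=
  linear_extension (fun b => let: (m, mu) := b in
    match n with
    | Posz 0 => (m%:~R * sqrt2) *: fock_basis (m, mu)
    | Posz p.+1 => (p.+1 * mu p)%N%:R *: fock_basis (m, (mu `\ p)%mset)
    | Negz p => fock_basis (m, (p +` mu)%mset)
    end).

(** [exp (eps sqrt2 q)]. *)
Definition exp_q (eps : int) : F -> F :=
  linear_extension (fun b => fock_basis (b.1 + eps, b.2)).

(** The coefficient of [z^-n] in [phi(z)], for [n != 0]. *)
Definition phi_coef (n : int) (v : F) : F := (- n%:~R)^-1 *: heis n v.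

(** For [X(w) = sum_(r > 0) x_r w^r], the coefficients of [w^k] in [X(w)^j] and
    in [exp X(w)]; only [j <= k] contribute to the latter. *)
Fixpoint pow_coef (x : nat -> F -> F) (j k : nat) (v : F) : F :=
  match j with
  | 0 => if k == 0%N then v else 0
  | j'.+1 => \sum_(r < k) x r.+1 (pow_coef x j' (k - r.+1) v)
  end.

Definition exp_coef (x : nat -> F -> F) (k : nat) (v : F) : F :=
  \sum_(j < k.+1) ((j`!)%:R)^-1 *: pow_coef x j k v.

(** Coefficient of [z^k] in [exp (eps sqrt2 sum_(n < 0) a_n / (-n) z^-n)]. *)
Definition creation_coef (eps : int) : nat -> F -> F :=
  exp_coef (fun r v => (eps%:~R * sqrt2) *: phi_coef (- r%:Z) v).

(** Coefficient of [z^-l] in [exp (eps sqrt2 sum_(n > 0) a_n / (-n) z^-n)]. *)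
Definition annihilation_coef (eps : int) : nat -> F -> F :=
  exp_coef (fun r v => (eps%:~R * sqrt2) *: phi_coef r%:Z v).

Definition energy (mu : {mset nat}) : nat := \sum_(p <- enum_mset mu) p.+1.

(** The coefficient of [z^(-n-1)] in
    [:exp (eps sqrt2 phi(z)): =
       exp (eps sqrt2 q) * creation part * annihilation part * z^(eps sqrt2 a_0)].
    On [F_(m sqrt2)] the last factor is [z^(2 eps m)], so the exponent of [z] is
    [k - l + 2 eps m], which leaves the sum over [l], with
    [k = l - n - 1 - 2 eps m] required to be nonnegative; the annihilation
    coefficients with [l > energy mu] vanish on the basis vector [(m, mu)]. *)
Definition vertex_mode (eps n : int) : F -> F :=
  linear_extension (fun b => let: (m, mu) := b in
    \sum_(l < (energy mu).+1)
      match l%:Z - n - 1 - 2 * eps * m with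
      | Posz k =>
          exp_q eps (creation_coef eps k
            (annihilation_coef eps l (fock_basis (m, mu))))
      | Negz _ => 0
      end).

(** The currents [e(z) = :exp(sqrt2 phi):], [f(z) = :exp(- sqrt2 phi):],
    [h(z) = sqrt2 phi'(z)], where [phi'(z) = sum_n a_n z^(-n-1)]. *)
Definition fock_ops : affine_ops F := {|
  act_e := vertex_mode 1;
  act_f := vertex_mode (-1);
  act_h := fun n v => sqrt2 *: heis n v;
  act_K := id
|}.

(** * Semi-infinite monomials

    A sequence [i_1, i_2, ...] is a function [i : nat -> int] with
    [i k = i_(k+1)]. *)

(** [e_(i_1) ... e_(i_N) v]. *)
Definition finite_monomial (i : nat -> int) (N : nat) (v : F) : F :=
  foldr (fun k w => act_e fock_ops (i k) w) v (iota 0 N).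

End LatticeFock.

Definition admissible (i : nat -> int) : Prop :=
  [/\ forall k, i k < i k.+1,
      forall k, 2 <= i k.+1 - i k,
      exists M, forall k, (M <= k)%N -> (i k = 1 %[mod 2])%Z &
      exists M, forall k, (M <= k)%N -> i k.+1 - i k = 2].

(** From position [N + 1] on, the sequence is that of
    [|j sqrt2> = e_(-2j+1) e_(-2j+3) e_(-2j+5) ...]. *)
Definition has_tail (i : nat -> int) (N : nat) (j : int) : Prop :=
  forall r : nat, i (N + r)%N = - (2 * j) + (2 * r.+1)%:Z - 1.

(** The vector [e_(i_1) e_(i_2) ...], computed from some choice of [N] and
    [j]. *)
Definition semi_infinite_monomial (C : numClosedFieldType) (i : nat -> int)
    : Fock C :=
  let Nj := xget (0%N, 0 : int)
              ((fun p => has_tail i p.1 p.2) : set (nat * int)) in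
  finite_monomial i Nj.1 (ket Nj.2).

(* Main.v *)
From HB Require Import structures.
Require Import Defs.
From mathcomp Require Import all_boot all_order all_algebra.
From mathcomp Require Import complex reals.
From mathcomp Require Import finmap multiset monalg boolp classical_sets.
From mathcomp Require Import zify ring.

Set Implicit Arguments.
Unset Strict Implicit.
Unset Printing Implicit Defensive.

Import Order.TTheory GRing.Theory Num.Theory.
Local Open Scope ring_scope.

(** Write [P_k] and [A_l] for the coefficients of the creation and annihilation
    parts of a vertex operator, so that the modes of [e(z)] and [f(z)] are sums
    of products [exp(+-sqrt2 q) P_k A_l].

    Module structure. Taking derivations of exponentials gives
    [[a_r, e_n] = sqrt2 e_(n+r)] and [[a_r, f_n] = - sqrt2 f_(n+r)]
    ([heis_vop]). Hence, for each bracket relation between the [e_n] and [f_n],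
    the family of its defects (left side minus right side, over all pairs of
    modes) is stable under bracketing with the [a_r]. Such a family vanishes as
    soon as its matrix coefficients between vacua do ([family_vanishes]), and
    these are Taylor coefficients of [(1 - x)^2] or [(1 - x)^(-2)]. The same
    criterion gives
    [e_n P_k = P_k e_n - 2 P_(k-1) e_(n-1) + P_(k-2) e_(n-2)] ([vop_crea]).
    Irreducibility and cyclicity hold because the [a_r] with [r > 0] lower any
    nonzero vector to a combination of vacua, [h_0] separates the vacua, the
    modes [e_(-2m-1)] and [f_(2m-1)] connect them, and the [a_r] with [r < 0]
    build everything from them.

    Basis. An admissible sequence of charge [m] differs from the sequence of
    [|m sqrt2>] by a partition [lambda]: [i_k = - 2 m + 2 k - 1 - lambda_k].
    Let [h_lambda = P_(lambda_1) P_(lambda_2) ... |m sqrt2>]. By [vop_crea], the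
    monomial of [lambda] is [h_lambda] plus a combination of products [h_t]
    with [t] strictly above [lambda] in the dominance order
    ([monomial_of_partsP]); this is the expansion of
    [prod_(a < b) (z_a - z_b)^2 prod_a P(z_a)], where every exponent of the
    squared Vandermonde determinant is dominated by the leading one. Dominance
    preserves the energy and strictly increases the sum of the squares of the
    parts, so the monomials are unitriangular over the [h_lambda]. In turn the
    [h_lambda] are triangular over the basis of products of the [a_(-n)],
    graded by the number of factors, because [P_k] is a nonzero multiple of
    [a_(-k)] plus products of several factors ([crea_prod_lead]). *)

(** * Linear operators and supports *)

Section LinearOperators.
Context {C : numClosedFieldType}.
Local Notation F := (Fock C).
Implicit Types (f g : F -> F) (u v : F) (b : fock_index).

Lemma linfun0 f : linear f -> f 0 = 0.
Proof. by move=> lf; have := lf (-1) 0 0; rewrite scaler0 addr0 scaleN1r addNr. Qed.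

Lemma linfunD f : linear f -> {morph f : u v / u + v}.
Proof. by move=> lf u v; have := lf 1 u v; rewrite !scale1r. Qed.

Lemma linfunZ f c : linear f -> {morph f : u / c *: u}.
Proof. by move=> lf u; have := lf c u 0; rewrite (linfun0 lf) !addr0. Qed.

Lemma linfunB f : linear f -> {morph f : u v / u - v}.
Proof.
by move=> lf u v; rewrite (linfunD lf) -!scaleN1r (linfunZ _ lf).
Qed.

Lemma linfun_sum f (I : Type) (r : seq I) (P : pred I) (E : I -> F) : linear f ->
  f (\sum_(i <- r | P i) E i) = \sum_(i <- r | P i) f (E i).
Proof. by move=> lf; apply: big_morph; [exact: linfunD|exact: linfun0]. Qed.

Lemma linear_comp f g : linear f -> linear g -> linear (f \o g).
Proof. by move=> lf lg c u v; rewrite /= lg lf. Qed.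

Lemma linear_scale f c : linear f -> linear (fun v => c *: f v).
Proof. by move=> lf a u v; rewrite lf scalerDr !scalerA mulrC. Qed.

Lemma linear_add f g : linear f -> linear g -> linear (fun v => f v + g v).
Proof. by move=> lf lg a u v; rewrite lf lg scalerDr addrACA. Qed.

Lemma linear_sub f g : linear f -> linear g -> linear (fun v => f v - g v).
Proof. by move=> lf lg a u v; rewrite lf lg scalerBr opprD addrACA. Qed.

Lemma linear_fun_sum (I : Type) (r : seq I) (P : pred I) (E : I -> F -> F) :
  (forall i, linear (E i)) -> linear (fun v => \sum_(i <- r | P i) E i v).
Proof.
move=> lE a u v; rewrite scaler_sumr -big_split /=.
by apply: eq_bigr => i _; rewrite lE.
Qed.

Lemma linear_zero : linear (fun _ : F => 0 : F).
Proof. by move=> a u v; rewrite scaler0 addr0. Qed.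

Lemma linear_commutator f g : linear f -> linear g -> linear (commutator f g).
Proof.
by move=> lf lg; apply: linear_sub; apply: linear_comp.
Qed.

Lemma mcoeff_sum (I : Type) (r : seq I) (P : pred I) (E : I -> F) b :
  mcoeff b (\sum_(i <- r | P i) E i) = \sum_(i <- r | P i) mcoeff b (E i).
Proof. by apply: big_morph; [exact: mcoeffD|exact: mcoeff0]. Qed.

Lemma mcoeff_basis b b' : mcoeff b' (fock_basis b : F) = (b == b')%:R.
Proof. by rewrite /fock_basis mcoeffU. Qed.

Lemma linear_extension_sum (g : fock_index -> F) v (d : {fset fock_index}) :
  (msupp v `<=` d)%fset ->
  linear_extension g v = \sum_(b <- d) mcoeff b v *: g b.
Proof.
move=> sd; rewrite /linear_extension; apply: big_fset_incl => // b _ bv.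
by rewrite mcoeff_outdom // scale0r.
Qed.

Lemma linear_extension_linear (g : fock_index -> F) :
  linear (linear_extension g).
Proof.
move=> c u v; pose d := (msupp u `|` msupp v)%fset.
rewrite (@linear_extension_sum _ u d) ?fsubsetUl //.
rewrite (@linear_extension_sum _ v d) ?fsubsetUr //.
rewrite (@linear_extension_sum _ _ d); last first.
  apply: (fsubset_trans (msuppD_le _ _)); apply: fsetSU; exact: msuppZ_le.
rewrite scaler_sumr -big_split; apply: eq_bigr => b _ /=.
by rewrite mcoeffD mcoeffZ scalerDl scalerA.
Qed.

Lemma linear_extension_basis (g : fock_index -> F) b :
  linear_extension g (fock_basis b) = g b.
Proof.
rewrite (@linear_extension_sum _ _ [fset b]%fset); last exact: msuppU_le.
by rewrite big_seq_fset1 mcoeff_basis eqxx scale1r.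
Qed.

Lemma fock_expand v : v = \sum_(b <- msupp v) mcoeff b v *: fock_basis b.
Proof.
rewrite {1}[v]monalgE; apply: eq_bigr => b _; apply/malgP => b'.
by rewrite mcoeffZ mcoeff_basis mcoeffU mulr_natr.
Qed.

Lemma linfun_expand f v : linear f ->
  f v = \sum_(b <- msupp v) mcoeff b v *: f (fock_basis b).
Proof.
move=> lf; rewrite {1}[v]fock_expand linfun_sum //.
by apply: eq_bigr => b _; rewrite linfunZ.
Qed.

Lemma eq_on_basis f g : linear f -> linear g ->
  (forall b, f (fock_basis b) = g (fock_basis b)) -> f =1 g.
Proof.
move=> lf lg fg v; rewrite (linfun_expand v lf) (linfun_expand v lg).
by apply: eq_bigr => b _; rewrite fg.
Qed.

Definition supp_in (S : fock_index -> Prop) v : Prop :=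
  forall b, mcoeff b v != 0 -> S b.

Lemma supp_in0 S : supp_in S 0.
Proof. by move=> b; rewrite mcoeff0 eqxx. Qed.

Lemma supp_inD S u v : supp_in S u -> supp_in S v -> supp_in S (u + v).
Proof.
move=> Su Sv b; rewrite mcoeffD => nz.
have [u0|/Su//] := eqVneq (mcoeff b u) 0.
by apply: Sv; rewrite u0 add0r in nz.
Qed.

Lemma supp_inZ S c v : supp_in S v -> supp_in S (c *: v).
Proof.
by move=> Sv b; rewrite mcoeffZ mulf_eq0 negb_or => /andP[_ /Sv].
Qed.

Lemma supp_in_sum S (I : Type) (r : seq I) (P : pred I) (E : I -> F) :
  (forall i, P i -> supp_in S (E i)) -> supp_in S (\sum_(i <- r | P i) E i).
Proof.
by move=> SE; elim/big_ind: _ => //; [exact: supp_in0|exact: supp_inD].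
Qed.

Lemma supp_in_basis (S : _ -> Prop) b : S b -> supp_in S (fock_basis b).
Proof. by move=> Sb b1; rewrite mcoeff_basis; have [<-|] := eqVneq b b1; rewrite ?eqxx. Qed.

Lemma supp_in_sub (S T : _ -> Prop) v : (forall b, S b -> T b) ->
  supp_in S v -> supp_in T v.
Proof. by move=> ST Sv b /Sv/ST. Qed.

Lemma supp_in_linear S T f v : linear f ->
  (forall b, S b -> supp_in T (f (fock_basis b))) ->
  supp_in S v -> supp_in T (f v).
Proof.
move=> lf ST Sv; rewrite (linfun_expand v lf) big_seq_cond.
apply: supp_in_sum => b /andP[bv _]; apply: supp_inZ; apply: ST; apply: Sv.
by rewrite mcoeff_neq0.
Qed.

Lemma supp_in_linear_eq S f g v : linear f -> linear g ->
  (forall b, S b -> f (fock_basis b) = g (fock_basis b)) ->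
  supp_in S v -> f v = g v.
Proof.
move=> lf lg fg Sv; rewrite (linfun_expand v lf) (linfun_expand v lg).
rewrite [LHS]big_seq_cond [RHS]big_seq_cond; apply: eq_bigr => b /andP[bv _].
by rewrite fg //; apply: Sv; rewrite mcoeff_neq0.
Qed.

End LinearOperators.

(** * Exponentials of families of operators *)

Section ExpCoef.
Context {C : numClosedFieldType}.
Local Notation F := (Fock C).
Variable x : nat -> F -> F.
Hypothesis x_linear : forall r, linear (x r).
Implicit Types (u v : F).

Lemma pow_coef_linear j n : linear (pow_coef x j n).
Proof.
elim: j n => [|j IHj] n /=.
  by case: (n == 0%N); [move=> a u v|exact: linear_zero].
by apply: linear_fun_sum => r; apply: linear_comp.
Qed.

Lemma exp_coef_linear n : linear (exp_coef x n).
Proof. by apply: linear_fun_sum => j; apply/linear_scale/pow_coef_linear. Qed.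

Lemma pow_coef_eq0 j n v : (n < j)%N -> pow_coef x j n v = 0.
Proof.
elim: j n => [//|j IHj] n nj /=; rewrite big1 // => r _.
by rewrite IHj ?linfun0 //; have := ltn_ord r; lia.
Qed.

Lemma exp_coef_trunc n B v : (n < B)%N ->
  exp_coef x n v = \sum_(j < B) ((j`!)%:R)^-1 *: pow_coef x j n v.
Proof.
move=> nB; rewrite /exp_coef.
rewrite (big_ord_widen B (fun j => ((j`!)%:R)^-1 *: pow_coef x j n v)) //.
rewrite big_mkcond /=; apply: eq_bigr => j _; case: ltnP => // nj.
by rewrite pow_coef_eq0 ?scaler0.
Qed.

Lemma pow_coef1 n v : pow_coef x 1 n.+1 v = x n.+1 v.
Proof.
rewrite /= big_ord_recr /= subnn big1 ?add0r // => r _.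
by rewrite subSS subn_eq0 leqNgt ltn_ord linfun0.
Qed.

Lemma supp_in_pow_coef (S : nat -> nat -> fock_index -> Prop) j n v :
  (forall r j n v, supp_in (S j n) v -> supp_in (S j.+1 (n + r.+1)%N) (x r.+1 v)) ->
  supp_in (S 0%N 0%N) v -> supp_in (S j n) (pow_coef x j n v).
Proof.
move=> Sx Sv; elim: j n => [|j IHj] n /=.
  by case: eqP => [->//|_]; exact: supp_in0.
apply: supp_in_sum => r _; have := Sx r j (n - r.+1)%N _ (IHj _).
by rewrite subnK //; exact.
Qed.

Lemma exp_coef_commutes (X : F -> F) n v : linear X ->
  (forall r v, X (x r v) = x r (X v)) ->
  X (exp_coef x n v) = exp_coef x n (X v).
Proof.
move=> lX Xx.
have pC j : forall m, X (pow_coef x j m v) = pow_coef x j m (X v).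
  elim: j => [|j IHj] m /=; first by case: (m == 0%N); rewrite ?linfun0.
  by rewrite linfun_sum //; apply: eq_bigr => r _; rewrite Xx IHj.
rewrite /exp_coef linfun_sum //; apply: eq_bigr => j _.
by rewrite linfunZ // pC.
Qed.

Lemma pow_coef_commutator (X : F -> F) (c : C) k j n v : linear X -> (0 < k)%N ->
  (forall r v, X (x r v) = x r (X v) + (if r == k then c else 0) *: v) ->
  X (pow_coef x j n v) = pow_coef x j n (X v)
    + (if (k <= n)%N then (j%:R * c) *: pow_coef x j.-1 (n - k) v else 0).
Proof.
move=> lX k0 Xx; elim: j n => [|j IHj] n /=.
  rewrite mul0r scale0r if_same addr0.
  by case: (n == 0%N); rewrite ?linfun0.
rewrite (linfun_sum _ _ _ lX).
transitivity (\sum_(i < n) (x i.+1 (pow_coef x j (n - i.+1) (X v))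
    + (x i.+1 (if (k <= n - i.+1)%N
        then (j%:R * c) *: pow_coef x j.-1 (n - i.+1 - k) v else 0)
    + (if i.+1 == k then c else 0) *: pow_coef x j (n - i.+1) v))).
  by apply: eq_bigr => i _; rewrite Xx IHj (linfunD (x_linear _)) -addrA.
rewrite big_split /=; congr (_ + _); rewrite big_split /= addrC.
have -> : \sum_(i < n) (if i.+1 == k then c else 0) *: pow_coef x j (n - i.+1) v
    = if (k <= n)%N then c *: pow_coef x j (n - k) v else 0.
  case: leqP => kn; last first.
    rewrite big1 // => i _; case: eqP => [ik|]; last by rewrite scale0r.
    by have := ltn_ord i; lia.
  have kn' : (k.-1 < n)%N by lia.
  rewrite (bigD1 (Ordinal kn')) //= prednK // eqxx big1 ?addr0 // => i.
  rewrite -val_eqE /= => ik; case: eqP => [ik'|]; last by rewrite scale0r.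
  by rewrite -ik' eqxx in ik.
have -> : \sum_(i < n) x i.+1 (if (k <= n - i.+1)%N
      then (j%:R * c) *: pow_coef x j.-1 (n - i.+1 - k) v else 0)
    = if (k <= n)%N then (j%:R * c) *: pow_coef x j (n - k) v else 0.
  case: j {IHj} => [|j].
    rewrite !mul0r scale0r if_same big1 // => i _.
    by rewrite scale0r if_same linfun0.
  case: leqP => kn; last first.
    by rewrite big1 // => i _; case: leqP => ?; [lia|rewrite linfun0].
  rewrite /= scaler_sumr.
  rewrite (big_ord_widen n (fun i => (j.+1%:R * c) *:
     x i.+1 (pow_coef x j (n - k - i.+1) v))) ?leq_subr // [RHS]big_mkcond /=.
  apply: eq_bigr => i _.
  have -> : (k <= n - i.+1)%N = (i < n - k)%N by apply/idP/idP; lia.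
  case: ltnP => ik; last by rewrite linfun0.
  by rewrite linfunZ //; congr (_ *: x _ (pow_coef x _ _ _)); lia.
case: leqP => kn; last by rewrite addr0.
by rewrite -scalerDl -natr1 mulrDl mul1r addrC.
Qed.

(** A derivation that sends [x_k] to a scalar [c] and kills every other [x_r]
    differentiates [exp X(w)] to [c w^k exp X(w)]. *)
Lemma exp_coef_commutator (X : F -> F) (c : C) k n v : linear X -> (0 < k)%N ->
  (forall r v, X (x r v) = x r (X v) + (if r == k then c else 0) *: v) ->
  X (exp_coef x n v) = exp_coef x n (X v)
    + (if (k <= n)%N then c *: exp_coef x (n - k) v else 0).
Proof.
move=> lX k0 Xx; rewrite {1 2}/exp_coef linfun_sum //.
have XE j := pow_coef_commutator j n v lX k0 Xx.
under eq_bigr => j _ do rewrite (linfunZ _ lX) XE scalerDr.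
rewrite big_split; congr (_ + _) => /=; case: leqP => kn; last first.
  by rewrite big1 // => j _; rewrite scaler0.
rewrite big_ord_recl mul0r scale0r scaler0 add0r.
rewrite (@exp_coef_trunc _ n); last by lia.
rewrite scaler_sumr; apply: eq_bigr => j _; rewrite lift0 !scalerA factS natrM.
congr (_ *: _); have : j.+1%:R != 0 :> C by rewrite pnatr_eq0.
have : (j`!)%:R != 0 :> C by rewrite pnatr_eq0 -lt0n fact_gt0.
by move: j.+1%:R j`!%:R => a b b0 a0; field; rewrite ?a0 ?b0.
Qed.

Lemma big_triangle (G : nat -> nat -> F) n :
  \sum_(r < n) \sum_(s < n - r.+1) G r s = \sum_(s < n) \sum_(r < n - s.+1) G r s.
Proof.
have widen (H : nat -> nat -> F) : \sum_(r < n) \sum_(s < n - r.+1) H r s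
    = \sum_(r < n) \sum_(s < n) if (r + s.+1 < n)%N then H r s else 0.
  apply: eq_bigr => r _; rewrite (big_ord_widen n (H r)) ?leq_subr //.
  rewrite big_mkcond; apply: eq_bigr => s _.
  by have -> : (s < n - r.+1)%N = (r + s.+1 < n)%N by apply/idP/idP; lia.
rewrite (widen G) (widen (fun s r => G r s)) exchange_big.
by apply: eq_bigr => s _; apply: eq_bigr => r _; rewrite !addnS addnC.
Qed.

Hypothesis xC : forall r s v, x r (x s v) = x s (x r v).

Lemma pow_coef_euler j n v : n%:R *: pow_coef x j.+1 n v
  = j.+1%:R *: \sum_(r < n) r.+1%:R *: x r.+1 (pow_coef x j (n - r.+1) v).
Proof.
elim: j n => [|j IHj] n.
  rewrite scale1r [pow_coef _ _ _ _]/= scaler_sumr; apply: eq_bigr => r _ /=.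
  case: eqP => [rn|]; last by rewrite linfun0 // !scaler0.
  by congr (_%:R *: _); have := ltn_ord r; lia.
rewrite [pow_coef _ _ _ _]/= scaler_sumr.
transitivity (\sum_(r < n) (r.+1%:R *: x r.+1 (pow_coef x j.+1 (n - r.+1) v)
   + \sum_(s < n - r.+1) (j.+1%:R * s.+1%:R)
        *: x r.+1 (x s.+1 (pow_coef x j (n - r.+1 - s.+1) v)))).
  apply: eq_bigr => r _; have rn := ltn_ord r.
  rewrite -{1}(subnKC rn) natrD scalerDl; congr (_ + _).
  rewrite -linfunZ // IHj linfunZ // linfun_sum // scaler_sumr.
  by apply: eq_bigr => s _; rewrite linfunZ // scalerA.
rewrite big_split /= (@big_triangle (fun r s => (j.+1%:R * s.+1%:R)
        *: x r.+1 (x s.+1 (pow_coef x j (n - r.+1 - s.+1) v)))).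
rewrite -[j.+2%:R]natr1 scalerDl scale1r addrC; congr (_ + _).
rewrite scaler_sumr; apply: eq_bigr => r _; rewrite (linfun_sum _ _ _ (x_linear _)).
rewrite scalerA scaler_sumr; apply: eq_bigr => s _.
by rewrite xC -!subnDA addnC.
Qed.

(** The logarithmic derivative [w d/dw exp X = (w d/dw X) exp X]. *)
Lemma exp_coef_euler n v : n%:R *: exp_coef x n v
  = \sum_(r < n) r.+1%:R *: x r.+1 (exp_coef x (n - r.+1) v).
Proof.
rewrite /exp_coef scaler_sumr big_ord_recl.
have -> : n%:R *: (((@ord0 n)`!)%:R^-1 *: pow_coef x (@ord0 n) n v) = 0.
  by rewrite /=; case: eqP => [->|]; rewrite ?scale0r ?scaler0.
rewrite add0r; under eq_bigr => j _.
  rewrite scalerA mulrC -scalerA lift0 pow_coef_euler scalerA scaler_sumr.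
  over.
rewrite exchange_big /=; apply: eq_bigr => r _; have rn := ltn_ord r.
rewrite -/(exp_coef x (n - r.+1) v) (@exp_coef_trunc _ n); last by lia.
rewrite (linfun_sum _ _ _ (x_linear _)) scaler_sumr; apply: eq_bigr => j _.
rewrite (linfunZ _ (x_linear _)) !scalerA factS natrM; congr (_ *: _).
have : j.+1%:R != 0 :> C by rewrite pnatr_eq0.
have : (j`!)%:R != 0 :> C by rewrite pnatr_eq0 -lt0n fact_gt0.
by move: j.+1%:R j`!%:R => a b b0 a0; field; rewrite ?a0 ?b0.
Qed.

End ExpCoef.

(** * Partitions as multisets *)

Section Multisets.
Local Open Scope mset_scope.
Implicit Types (p q : nat) (mu : {mset nat}).

Lemma perm_mset1D p mu : perm_eq (enum_mset (p +` mu)) (p :: enum_mset mu).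
Proof.
rewrite -[X in p +` X]seq_mset_id -mset_cons; exact: perm_eq_seq_mset.
Qed.

Lemma size_mset1D p mu : size (enum_mset (p +` mu)) = (size (enum_mset mu)).+1.
Proof. by rewrite (perm_size (perm_mset1D p mu)). Qed.

Lemma energy1D p mu : energy (p +` mu) = (p.+1 + energy mu)%N.
Proof. by rewrite /energy (perm_big _ (perm_mset1D p mu)) big_cons. Qed.

Lemma energy0 : energy mset0 = 0%N.
Proof. by rewrite /energy enum_mset0 big_nil. Qed.

Lemma seq_mset_nil : seq_mset [::] = mset0 :> {mset nat}.
Proof. by apply/msetP => p; rewrite mset_seqE mset0E. Qed.

Lemma mset_ind (Q : {mset nat} -> Prop) : Q mset0 ->
  (forall p mu, Q mu -> Q (p +` mu)) -> forall mu, Q mu.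
Proof.
move=> Q0 QD mu; rewrite -[mu]seq_mset_id.
elim: (enum_mset mu) => [|p s IHs]; first by rewrite seq_mset_nil.
by rewrite mset_cons; apply: QD.
Qed.

Lemma size_le_energy mu : (size (enum_mset mu) <= energy mu)%N.
Proof.
elim/mset_ind: mu => [|p mu IH]; first by rewrite enum_mset0.
by rewrite size_mset1D energy1D; lia.
Qed.

Lemma msetB1_1D p q mu : p != q -> (q +` mu) `\ p = q +` (mu `\ p).
Proof.
move=> pq; apply/msetP => r; rewrite msetB1E !mset1DE msetB1E.
have [->|] := eqVneq r p; last by rewrite !subn0.
by rewrite (negbTE pq).
Qed.

End Multisets.

(** * The Heisenberg operators *)

Section Heisenberg.
Context {C : numClosedFieldType}.
Local Notation F := (Fock C).
Local Notation sqrt2 := (sqrtC (2%:R : C)).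
Local Open Scope mset_scope.
Implicit Types (m n : int) (p q : nat) (mu : {mset nat}) (v : F).

Lemma sqrt2M : sqrt2 * sqrt2 = 2%:R.
Proof. by rewrite -expr2 sqrtCK. Qed.

Lemma sqrt2_neq0 : sqrt2 != 0.
Proof. by rewrite sqrtC_eq0 pnatr_eq0. Qed.

Lemma heis_linear n : linear (@heis C n).
Proof. exact: linear_extension_linear. Qed.

Lemma exp_q_linear eps : linear (@exp_q C eps).
Proof. exact: linear_extension_linear. Qed.

Lemma heis0_basis m mu :
  heis 0 (fock_basis (m, mu)) = (m%:~R * sqrt2) *: fock_basis (m, mu) :> F.
Proof. by rewrite /heis linear_extension_basis. Qed.

Lemma heis_pos_basis p m mu : heis p.+1%:Z (fock_basis (m, mu))
  = (p.+1 * mu p)%N%:R *: fock_basis (m, mu `\ p) :> F.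
Proof. by rewrite /heis linear_extension_basis. Qed.

Lemma heis_neg_basis p m mu :
  heis (- p.+1%:Z) (fock_basis (m, mu)) = fock_basis (m, p +` mu) :> F.
Proof. by rewrite -NegzE /heis linear_extension_basis. Qed.

Lemma exp_q_basis eps m mu :
  exp_q eps (fock_basis (m, mu)) = fock_basis (m + eps, mu) :> F.
Proof. by rewrite /exp_q linear_extension_basis. Qed.

Lemma mcoeff_heis0 b v : mcoeff b (heis 0 v) = b.1%:~R * sqrt2 * mcoeff b v.
Proof.
rewrite (linfun_expand _ (heis_linear 0)) [in RHS](fock_expand v) !mcoeff_sum mulr_sumr.
apply: eq_bigr => -[m mu] _; rewrite heis0_basis !mcoeffZ mcoeff_basis.
by have [<-|_] := eqVneq (m, mu) b; rewrite ?mulr0 //= !mulr1 mulrC.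
Qed.

Lemma mcoeff_heis_pos p m mu v : mcoeff (m, mu) (heis p.+1%:Z v)
  = (p.+1 * (mu p).+1)%N%:R * mcoeff (m, p +` mu) v.
Proof.
rewrite (linfun_expand _ (heis_linear _)) [in RHS](fock_expand v) !mcoeff_sum mulr_sumr.
apply: eq_bigr => -[m' mu'] _; rewrite heis_pos_basis !mcoeffZ !mcoeff_basis.
rewrite [RHS]mulrCA; congr (_ * _); rewrite !xpair_eqE.
have [_|_] := eqVneq m' m; last by rewrite !mulr0.
have [->|ne] := eqVneq mu' (p +` mu).
  by rewrite msetD1K eqxx mset1DE eqxx.
case: eqP => [muE|]; last by rewrite !mulr0.
case: (posnP (mu' p)) => [->|]; first by rewrite muln0 mul0r mulr0.
by rewrite mset_gt0 => /msetB1K; rewrite /= muE => muE'; rewrite muE' eqxx in ne.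
Qed.

Lemma heis_commutator m n v : commutator (heis m) (heis n) v
  = (if m == - n then m%:~R else 0) *: v.
Proof.
have l1 := linear_commutator (@heis_linear m) (@heis_linear n).
have l2 : linear (fun v : F => (if m == - n then m%:~R else 0 : C) *: v).
  by apply: (@linear_scale _ id).
apply: (eq_on_basis l1 l2) => -[c mu] {v l1 l2}; rewrite /commutator.
have lh k : linear (@heis C k) by exact: heis_linear.
have mixed p q : heis p.+1%:Z (heis (- q.+1%:Z) (fock_basis (c, mu)))
     - heis (- q.+1%:Z) (heis p.+1%:Z (fock_basis (c, mu)))
     = (if p == q then p.+1%:R else 0) *: fock_basis (c, mu) :> F.
  rewrite heis_neg_basis !heis_pos_basis (linfunZ _ (lh _)) heis_neg_basis.
  have [<-|pq] := eqVneq p q; last first.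
    rewrite msetB1_1D // mset1DE (negbTE pq) add0n subrr scale0r //.
  rewrite msetD1K mset1DE eqxx.
  case: (posnP (mu p)) => [->|].
    by rewrite muln0 scale0r subr0 addn0 muln1.
  rewrite mset_gt0 => /msetB1K => ->.
  by rewrite -scalerBl -natrB ?leq_mul // -mulnBr addnK muln1.
case: m => [[|p]|p]; case: n => [[|q]|q]; rewrite -?[Posz 0]/(0 : int) ?NegzE.
- by rewrite subrr scale0r.
- rewrite heis_pos_basis (linfunZ _ (lh _)) !heis0_basis (linfunZ _ (lh _)).
  rewrite heis_pos_basis !scalerA mulrC subrr.
  by case: eqP => [|_]; rewrite scale0r.
- rewrite heis_neg_basis !heis0_basis (linfunZ _ (lh _)) heis_neg_basis.
  by rewrite subrr; case: eqP => [|_]; rewrite scale0r.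
- rewrite heis_pos_basis (linfunZ _ (lh _)) !heis0_basis (linfunZ _ (lh _)).
  by rewrite heis_pos_basis !scalerA [X in X *: _ - _]mulrC subrr oppr0 scale0r.
- rewrite !heis_pos_basis !(linfunZ _ (lh _)) !heis_pos_basis !scalerA.
  have -> : (p.+1%:Z == - q.+1%:Z) = false by apply/eqP; lia.
  rewrite scale0r; have [->|pq] := eqVneq p q; first by rewrite subrr.
  have -> : mu `\ p `\ q = mu `\ q `\ p.
    by apply/msetP => r; rewrite !msetB1E subnAC.
  rewrite !msetB1E (negbTE pq) eq_sym (negbTE pq) !subn0.
  by rewrite -scalerBl [X in X - _]mulrC subrr scale0r.
- by rewrite mixed opprK eqz_nat eqSS.
- rewrite heis_neg_basis !heis0_basis (linfunZ _ (lh _)) heis_neg_basis.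
  by rewrite subrr oppr0; case: eqP => [|_]; rewrite ?scale0r.
- rewrite -opprB mixed -scaleNr; congr (_ *: _); rewrite eqr_opp eqz_nat eqSS.
  by rewrite eq_sym; case: eqP => [->|]; rewrite ?oppr0 ?mulrNz.
- rewrite !heis_neg_basis opprK.
  have -> : (- p.+1%:Z == q.+1%:Z) = false by apply/eqP; lia.
  by rewrite scale0r msetDCA subrr.
Qed.

Lemma heis_exp_q n eps v : heis n (exp_q eps v) = exp_q eps (heis n v)
  + (if n == 0 then eps%:~R * sqrt2 else 0) *: exp_q eps v.
Proof.
have lh k : linear (@heis C k) by exact: heis_linear.
have le := @exp_q_linear eps.
have l1 : linear (heis n \o exp_q eps : F -> F) by apply: linear_comp.
have l2 : linear (fun v : F => exp_q eps (heis n v)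
    + (if n == 0 then eps%:~R * sqrt2 else 0) *: exp_q eps v).
  by apply: linear_add; [exact: linear_comp|exact: linear_scale].
apply: (eq_on_basis l1 l2) => -[m mu] {v l1 l2} /=; rewrite exp_q_basis.
case: n => [[|p]|p]; rewrite -?[Posz 0]/(0 : int) ?NegzE.
- by rewrite !heis0_basis (linfunZ _ le) exp_q_basis -scalerDl intrD mulrDl.
- by rewrite !heis_pos_basis (linfunZ _ le) exp_q_basis scale0r addr0.
- rewrite !heis_neg_basis exp_q_basis; case: eqP => [|_]; first lia.
  by rewrite scale0r addr0.
Qed.

(** The charge is [c], the energy above [|c sqrt2>] is [d]; an integral [d] lets
    operators shift it freely, the component being zero for [d < 0]. *)
Definition homog (c d : int) : F -> Prop :=
  supp_in (fun b => b.1 = c /\ (energy b.2)%:Z = d).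

Lemma homog_basis m mu : homog m (energy mu) (fock_basis (m, mu)).
Proof. exact: supp_in_basis. Qed.

Lemma homog_ket m : homog m 0 (ket m).
Proof. by apply: supp_in_basis => /=; rewrite energy0. Qed.

Lemma homog_lt0 c d v : d < 0 -> homog c d v -> v = 0.
Proof.
move=> d0 vh; apply/malgP => b; rewrite mcoeff0; apply/eqP/negPn/negP => /vh.
by case=> _ E; rewrite -E in d0.
Qed.

Lemma homog_heis n c d v : homog c d v -> homog c (d - n) (heis n v).
Proof.
apply: supp_in_linear; first exact: heis_linear.
case=> m mu [/= -> <-]; case: n => [[|p]|p]; rewrite -?[Posz 0]/(0 : int) ?NegzE.
- by rewrite heis0_basis; apply: supp_inZ; apply: supp_in_basis; rewrite /= subr0.
- rewrite heis_pos_basis; case: (posnP (mu p)) => [->|].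
    by rewrite muln0 scale0r; exact: supp_in0.
  rewrite mset_gt0 => /msetB1K muE; apply: supp_inZ; apply: supp_in_basis; split => //=.
  by rewrite -{2}muE energy1D; lia.
- rewrite heis_neg_basis; apply: supp_in_basis; split => //=.
  by rewrite energy1D; lia.
Qed.

Lemma homog_exp_q eps c d v : homog c d v -> homog (c + eps) d (exp_q eps v).
Proof.
apply: supp_in_linear; first exact: exp_q_linear.
case=> m mu [/= -> <-]; rewrite exp_q_basis; exact: homog_basis.
Qed.

(** If [mu] contains [p], the coefficient of [v] at [(m, mu)] is, up to a nonzero
    factor, a coefficient of [a_(p+1) v]. *)
Lemma heis_kernel v : (forall p : nat, heis p.+1%:Z v = 0) ->
  supp_in (fun b => b.2 = mset0) v.
Proof.
move=> v0 [m mu] /=; elim/mset_ind: mu => // p mu _.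
have := mcoeff_heis_pos p m mu v; rewrite v0 mcoeff0 => /esym/eqP.
by rewrite mulf_eq0 pnatr_eq0 /= => /eqP ->; rewrite eqxx.
Qed.

Lemma heis_kernel_homog c d v : 0 < d -> homog c d v ->
  (forall p : nat, heis p.+1%:Z v = 0) -> v = 0.
Proof.
move=> d0 vh /heis_kernel vk; apply/malgP => b; rewrite mcoeff0.
apply/eqP/negPn/negP => nz; have [_] := vh b nz.
by rewrite (vk b nz) energy0 => E; rewrite -E in d0.
Qed.

End Heisenberg.
Arguments homog_heis {C} n {c d v}.
Arguments homog_exp_q {C} eps {c d v}.
Arguments homog_basis {C} m mu.
Arguments homog_ket {C} m.

(** * Vertex operators *)

Section PhiCoef.
Context {C : numClosedFieldType}.
Local Notation F := (Fock C).
Local Notation sqrt2 := (sqrtC (2%:R : C)).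
Implicit Types (eps m n r k l c d : int) (v : F).

Lemma phi_coef_linear s : linear (@phi_coef C s).
Proof. exact/linear_scale/heis_linear. Qed.

(** The factor [1 / (- s)] in [phi] normalizes the bracket to 1. *)
Lemma heis_phi_coef n s v : heis n (phi_coef s v) = phi_coef s (heis n v)
  + (if (n == - s) && (n != 0) then 1 else 0) *: v.
Proof.
rewrite /phi_coef (linfunZ _ (heis_linear _)).
have -> : heis n (heis s v) = heis s (heis n v) + commutator (heis n) (heis s) v.
  by rewrite /commutator addrC subrK.
rewrite heis_commutator scalerDr scalerA; congr (_ + _ *: _).
have [->|_] := eqVneq n (- s); last by rewrite mulr0.
have [/eqP|s0] := eqVneq (- s) 0; last first.
  by rewrite mulrNz mulVf // -mulrNz intr_eq0.
by rewrite oppr_eq0 => /eqP ->; rewrite oppr0 mulr0.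
Qed.

End PhiCoef.

(** The coefficients [P_k] and [A_l] of the creation and annihilation parts,
    with an integral index so that sums over them can be shifted freely, and a
    copy of the vertex modes. They are locked because unification would
    otherwise unfold them whenever two distinct composites are compared. *)
HB.lock Definition crea {C : numClosedFieldType} (eps k : int) (v : Fock C) :
  Fock C := if k is Posz n then creation_coef eps n v else 0.

HB.lock Definition anni {C : numClosedFieldType} (eps l : int) (v : Fock C) :
  Fock C := if l is Posz n then annihilation_coef eps n v else 0.

HB.lock Definition vop {C : numClosedFieldType} (eps n : int) (v : Fock C) :
  Fock C := vertex_mode eps n v.

Section VertexOperators.
Context {C : numClosedFieldType}.
Local Notation F := (Fock C).
Local Notation sqrt2 := (sqrtC (2%:R : C)).
Implicit Types (eps m n r k l c d : int) (v : F).

Let cgen eps (r : nat) v : F := (eps%:~R * sqrt2) *: phi_coef (- r%:Z) v.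
Let agen eps (r : nat) v : F := (eps%:~R * sqrt2) *: phi_coef r%:Z v.

Let cgen_linear eps (r : nat) : linear (cgen eps r).
Proof. exact/linear_scale/phi_coef_linear. Qed.

Let agen_linear eps (r : nat) : linear (agen eps r).
Proof. exact/linear_scale/phi_coef_linear. Qed.

Lemma creaE eps k v :
  crea eps k v = if k is Posz n then creation_coef eps n v else 0.
Proof. by rewrite crea.unlock. Qed.

Lemma anniE eps (l : nat) v : anni eps l v = annihilation_coef eps l v.
Proof. by rewrite anni.unlock. Qed.

Lemma crea_linear eps k : linear (@crea C eps k).
Proof.
rewrite crea.unlock.
by case: k => k; [exact: (exp_coef_linear (cgen_linear eps))|exact: linear_zero].
Qed.

Lemma anni_linear eps l : linear (@anni C eps l).
Proof.
rewrite anni.unlock.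
by case: l => l; [exact: (exp_coef_linear (agen_linear eps))|exact: linear_zero].
Qed.

Lemma crea0 eps v : crea eps 0 v = v.
Proof. by rewrite crea.unlock /= /creation_coef /exp_coef big_ord1 /= invr1 scale1r. Qed.

Lemma anni0 eps v : anni eps 0 v = v.
Proof. by rewrite anni.unlock /= /annihilation_coef /exp_coef big_ord1 /= invr1 scale1r. Qed.

Lemma crea_lt0 eps k v : k < 0 -> crea eps k v = 0.
Proof. by rewrite crea.unlock; case: k. Qed.

Lemma anni_lt0 eps l v : l < 0 -> anni eps l v = 0.
Proof. by rewrite anni.unlock; case: l. Qed.

Let heis_cgen n eps (r : nat) v : heis n (cgen eps r v) = cgen eps r (heis n v)
  + (if (n == r) && (n != 0) then eps%:~R * sqrt2 else 0) *: v.
Proof.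
rewrite /cgen (linfunZ _ (heis_linear _)) heis_phi_coef scalerDr scalerA opprK.
by case: ifP; rewrite ?mulr1 ?mulr0.
Qed.

Let heis_agen n eps (r : nat) v : heis n (agen eps r v) = agen eps r (heis n v)
  + (if (n == - r%:Z) && (n != 0) then eps%:~R * sqrt2 else 0) *: v.
Proof.
rewrite /agen (linfunZ _ (heis_linear _)) heis_phi_coef scalerDr scalerA.
by case: ifP; rewrite ?mulr1 ?mulr0.
Qed.

Lemma heis_crea r eps k v : heis r (crea eps k v) = crea eps k (heis r v)
  + (if 0 < r then eps%:~R * sqrt2 else 0) *: crea eps (k - r) v.
Proof.
case: k => [k|k]; last first.
  rewrite !(crea_lt0 _ (k := Negz _)) // (linfun0 (heis_linear _)) add0r; case: ltP => r0; last by rewrite scale0r.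
  by rewrite crea_lt0 ?scaler0 //; lia.
case: ltP => r0; last first.
  rewrite scale0r addr0 crea.unlock; apply: exp_coef_commutes => [|s w].
    exact: heis_linear.
  rewrite heis_cgen; case: ifP => [/andP[/eqP rs r00]|]; last first.
    by rewrite scale0r addr0.
  by move: r0 r00; rewrite rs; case: s {rs}.
case: r r0 => // r r0.
have Xx (s : nat) w : heis r (cgen eps s w) = cgen eps s (heis r w)
    + (if s == r then eps%:~R * sqrt2 else 0) *: w.
  rewrite heis_cgen eqz_nat eq_sym; case: eqP => //= ->.
  by case: r r0.
transitivity (crea eps k (heis r v) + (if (r <= k)%N
    then (eps%:~R * sqrt2) *: crea eps (k - r)%N v else 0)).
  rewrite crea.unlock.
  exact: (exp_coef_commutator (cgen_linear eps) k v (heis_linear r) r0 Xx).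
congr (_ + _); case: leqP => kr; last by rewrite crea_lt0 ?scaler0 //; lia.
by rewrite subzn.
Qed.

Lemma heis_anni r eps l v : heis r (anni eps l v) = anni eps l (heis r v)
  + (if r < 0 then eps%:~R * sqrt2 else 0) *: anni eps (l + r) v.
Proof.
case: l => [l|l]; last first.
  rewrite !(anni_lt0 _ (l := Negz _)) // (linfun0 (heis_linear _)) add0r; case: ltP => r0; last by rewrite scale0r.
  by rewrite anni_lt0 ?scaler0 //; lia.
case: ltP => r0; last first.
  rewrite scale0r addr0 anni.unlock; apply: exp_coef_commutes => [|s w].
    exact: heis_linear.
  rewrite heis_agen; case: ifP => [/andP[/eqP rs r00]|]; last first.
    by rewrite scale0r addr0.
  by move: r0 r00; rewrite rs; case: s {rs}.
case: r r0 => // r r0; rewrite NegzE.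
have Xx (s : nat) w : heis (- r.+1%:Z) (agen eps s w)
    = agen eps s (heis (- r.+1%:Z) w)
      + (if s == r.+1 then eps%:~R * sqrt2 else 0) *: w.
  by rewrite heis_agen eqr_opp eqz_nat eq_sym oppr_eq0 andbT.
transitivity (anni eps l (heis (- r.+1%:Z) v) + (if (r < l)%N
    then (eps%:~R * sqrt2) *: anni eps (l - r.+1)%N v else 0)).
  rewrite anni.unlock.
  exact: (exp_coef_commutator (agen_linear eps) l v (heis_linear _) (ltn0Sn r) Xx).
congr (_ + _); case: (leqP r.+1 l) => kr; last by rewrite anni_lt0 ?scaler0 //; lia.
by rewrite subzn.
Qed.

Lemma crea_commutes eps k v (X : F -> F) : linear X ->
  (forall (s : nat) w, X (phi_coef (- s%:Z) w) = phi_coef (- s%:Z) (X w)) ->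
  X (crea eps k v) = crea eps k (X v).
Proof.
move=> lX Xc; rewrite crea.unlock; case: k => k; last by rewrite (linfun0 lX).
by apply: exp_coef_commutes => // s w; rewrite (linfunZ _ lX) Xc.
Qed.

Lemma phi_coefC s t v : s != - t \/ s = 0 ->
  phi_coef s (phi_coef t v) = phi_coef t (phi_coef s v) :> F.
Proof.
move=> st; rewrite {1 4}/phi_coef heis_phi_coef (linfunZ _ (phi_coef_linear _)).
case: ifP => [/andP[/eqP E s0]|]; last by rewrite scale0r addr0.
by case: st => H; [rewrite E eqxx in H|rewrite H eqxx in s0].
Qed.

Lemma creaC eps k eps' k' v :
  crea eps k (crea eps' k' v) = crea eps' k' (crea eps k v).
Proof.
apply: crea_commutes => [|s w]; first exact: crea_linear.
symmetry; apply: crea_commutes => [|t u]; first exact: phi_coef_linear.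
by apply: phi_coefC; case: s => [|s]; [right|left; rewrite opprK; lia].
Qed.

Lemma exp_q_phi_coef eps s v :
  exp_q eps (phi_coef s v) = phi_coef s (exp_q eps v) :> F.
Proof.
rewrite /phi_coef (linfunZ _ (exp_q_linear _)) heis_exp_q.
case: eqP => [->|_]; last by rewrite scale0r addr0.
by rewrite oppr0 invr0 !scale0r.
Qed.

Lemma exp_q_crea eps' eps k v :
  exp_q eps' (crea eps k v) = crea eps k (exp_q eps' v).
Proof.
by apply: crea_commutes => [|s w]; [exact: exp_q_linear|exact: exp_q_phi_coef].
Qed.

Lemma homog_crea eps k c d v : homog c d v -> homog c (d + k) (crea eps k v).
Proof.
rewrite crea.unlock; case: k => k vh; last exact: supp_in0.
apply: supp_in_sum => j _; apply: supp_inZ.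
pose S (j n : nat) (b : fock_index) := b.1 = c /\ (energy b.2)%:Z = d + n%:Z.
apply: (@supp_in_pow_coef _ _ S) => [s i n w wh|].
  apply: supp_inZ; apply: supp_inZ.
  have -> : S i.+1 (n + s.+1)%N =
      fun b => b.1 = c /\ (energy b.2)%:Z = (d + n%:Z) - (- s.+1%:Z).
    by rewrite /S opprK PoszD addrA.
  exact: homog_heis.
by rewrite /S addr0.
Qed.

Lemma homog_anni eps l c d v : homog c d v -> homog c (d - l) (anni eps l v).
Proof.
rewrite anni.unlock; case: l => l vh; last exact: supp_in0.
apply: supp_in_sum => j _; apply: supp_inZ.
pose S (j n : nat) (b : fock_index) := b.1 = c /\ (energy b.2)%:Z = d - n%:Z.
apply: (@supp_in_pow_coef _ _ S) => [s i n w wh|].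
  apply: supp_inZ; apply: supp_inZ.
  have -> : S i.+1 (n + s.+1)%N =
      fun b => b.1 = c /\ (energy b.2)%:Z = (d - n%:Z) - s.+1%:Z.
    by rewrite /S PoszD opprD addrA.
  exact: homog_heis.
by rewrite /S subr0.
Qed.

Arguments homog_anni eps l {c d v}.
Arguments homog_crea eps k {c d v}.

Lemma vop_linear eps n : linear (@vop C eps n).
Proof. rewrite vop.unlock; exact: linear_extension_linear. Qed.

(** The sum over [l] defining a vertex mode may be extended to any common bound
    [B], so that the mode is given by one formula on all of a homogeneous
    component. *)
Lemma vopE eps n c d v (B : nat) : homog c d v -> d < B%:Z ->
  vop eps n v = \sum_(l < B)
    exp_q eps (crea eps (l%:Z - n - 1 - 2 * eps * c) (anni eps l v)).
Proof.
move=> vh dB; pose S (b : fock_index) := b.1 = c /\ (energy b.2)%:Z = d.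
pose rhs (v : F) := \sum_(l < B)
  exp_q eps (crea eps (l%:Z - n - 1 - 2 * eps * c) (anni eps l v)).
apply: (@supp_in_linear_eq _ S _ rhs _ _ _ _ vh); first exact: vop_linear.
  apply: linear_fun_sum => l; apply: linear_comp; first exact: exp_q_linear.
  by apply: linear_comp; [exact: crea_linear|exact: anni_linear].
case=> m mu [/= -> E]; rewrite vop.unlock /vertex_mode linear_extension_basis.
have muB : ((energy mu).+1 <= B)%N by lia.
transitivity (\sum_(l < (energy mu).+1) exp_q eps
    (crea eps (l%:Z - n - 1 - 2 * eps * c) (anni eps l (fock_basis (c, mu) : F)))).
  apply: eq_bigr => l _; set k := l%:Z - n - 1 - 2 * eps * c.
  rewrite creaE anniE; case: k => [k|k]; first by [].
  by rewrite (linfun0 (exp_q_linear _)).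
rewrite (big_ord_widen B (fun l : nat => exp_q eps (crea eps
   (l%:Z - n - 1 - 2 * eps * c) (anni eps l (fock_basis (c, mu)))))) //.
rewrite big_mkcond; apply: eq_bigr => l _; case: ltnP => // ml.
have := homog_anni eps l%:Z (@homog_basis C c mu).
move/homog_lt0 => ->; last by lia.
by rewrite (linfun0 (crea_linear _ _)) (linfun0 (exp_q_linear _)).
Qed.

Lemma homog_vop eps n c d v : homog c d v ->
  homog (c + eps) (d - n - 1 - 2 * eps * c) (vop eps n v).
Proof.
move=> vh; rewrite (@vopE eps n c d v `|d|.+1) //; last by lia.
apply: supp_in_sum => l _; apply: homog_exp_q.
have -> : d - n - 1 - 2 * eps * c = d - l%:Z + (l%:Z - n - 1 - 2 * eps * c).
  by ring.
exact/homog_crea/homog_anni.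
Qed.

(** Exactly one of the three factors of the vertex operator fails to commute with
    [a_r]: the creation part if [r > 0], the annihilation part if [r < 0], the
    charge shift if [r = 0]. *)
Lemma heis_vop r eps n v : heis r (vop eps n v)
  = vop eps n (heis r v) + (eps%:~R * sqrt2) *: vop eps (n + r) v.
Proof.
have lh k : linear (@heis C k) by exact: heis_linear.
have le := @exp_q_linear C eps.
have lc k := crea_linear eps k.
have lv k := @vop_linear eps k.
have l1 : linear (heis r \o vop eps n : F -> F) by apply: linear_comp.
have l2 : linear (fun v : F => vop eps n (heis r v)
    + (eps%:~R * sqrt2) *: vop eps (n + r) v).
  by apply: linear_add; [exact: linear_comp|exact: linear_scale].
apply: (eq_on_basis l1 l2) => -[c mu] {v l1 l2} /=; set v := fock_basis _.
have vh : homog c (energy mu) v by exact: homog_basis.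
have rvh := homog_heis r vh.
(* For [r < 0] the sum over [l] is shifted by [s = - r], hence the longer range. *)
pose s := if r < 0 then `|r|%N else 0%N.
pose B := (energy mu + `|r|).+1.
rewrite (@vopE eps n c _ v (s + B) vh); last by lia.
rewrite (@vopE eps n c _ _ (s + B) rvh); last by lia.
pose al := eps%:~R * sqrt2 : C.
have acF (x y z t : F) : x + y + z + t = x + (z + y + t).
  by rewrite (addrC z) !addrA.
pose T k l := exp_q eps (crea eps k (anni eps l v)).
pose kk (l : nat) := l%:Z - n - 1 - 2 * eps * c.
transitivity (\sum_(l < s + B)
   (exp_q eps (crea eps (kk l) (anni eps l (heis r v)))
   + ((if 0 < r then al else 0) *: T (kk l - r) l
     + (if r < 0 then al else 0) *: T (kk l) (l%:Z + r)
     + (if r == 0 then al else 0) *: T (kk l) l))).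
  rewrite (linfun_sum _ _ _ (lh _)); apply: eq_bigr => l _.
  rewrite heis_exp_q heis_crea heis_anni (linfunD (lc _)) !(linfunD le).
  rewrite (linfunZ _ (lc _)) !(linfunZ _ le); exact: acF.
rewrite big_split; congr (_ + _) => /=; rewrite -/al.
have [r0|r0|r0] := ltgtP r 0.
- under eq_bigr do rewrite !scale0r add0r addr0.
  have -> : s = `|r|%N by rewrite /s r0.
  rewrite big_split_ord /= big1 ?add0r => [|l _]; last first.
    rewrite /T anni_lt0; last by have := ltn_ord l; lia.
    by rewrite (linfun0 (lc _)) (linfun0 le) scaler0.
  rewrite (@vopE eps (n + r) c _ v B vh); last by lia.
  rewrite scaler_sumr; apply: eq_bigr => l _; rewrite /T /kk.
  by congr (_ *: exp_q _ (crea _ _ (anni _ _ _))); lia.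
- under eq_bigr do rewrite !scale0r !addr0.
  rewrite (@vopE eps (n + r) c _ v (s + B) vh); last by lia.
  rewrite scaler_sumr; apply: eq_bigr => l _; rewrite /T /kk.
  by congr (_ *: exp_q _ (crea _ _ _)); lia.
- under eq_bigr do rewrite !scale0r !add0r.
  rewrite (@vopE eps (n + r) c _ v (s + B) vh); last by lia.
  rewrite scaler_sumr; apply: eq_bigr => l _; rewrite /T /kk.
  by congr (_ *: exp_q _ (crea _ _ _)); lia.
Qed.

End VertexOperators.
Arguments homog_anni {C} eps l {c d v}.
Arguments homog_crea {C} eps k {c d v}.
Arguments homog_vop {C} eps n {c d v}.

(** * Vacuum coefficients and a vanishing criterion *)

Section VacuumCoefficients.
Context {C : numClosedFieldType}.
Local Notation F := (Fock C).
Local Notation sqrt2 := (sqrtC (2%:R : C)).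
Implicit Types (eps del m n r k c d : int) (v : F).

Lemma heis_ket (p : nat) m : heis p.+1%:Z (ket m) = 0 :> F.
Proof. by rewrite /ket heis_pos_basis mset0E muln0 scale0r. Qed.

Lemma anni_euler eps (l : nat) v : l%:R *: anni eps l v
  = - (eps%:~R * sqrt2) *: \sum_(r < l) heis r.+1%:Z (anni eps (l - r.+1)%N v).
Proof.
rewrite anniE /annihilation_coef exp_coef_euler => [|r|r s w].
- rewrite scaler_sumr; apply: eq_bigr => r _.
  rewrite anniE /annihilation_coef /phi_coef !scalerA.
  have r0 : r.+1%:~R != 0 :> C by rewrite intr_eq0.
  congr (_ *: _); rewrite -[r.+1%:R]/(r.+1%:~R) invrN.
  by rewrite mulrN mulrAC mulfV // mul1r.
- exact/linear_scale/phi_coef_linear.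
- rewrite (linfunZ _ (phi_coef_linear r)) (linfunZ _ (phi_coef_linear s)) phi_coefC //.
  by case: r => [|r]; [right|left; apply/eqP; lia].
Qed.

(** The annihilation part [A(z)] acts on [P(w) |m sqrt2>] as the scalar
    [(1 - w/z)^(2 eps del)]. The Taylor coefficients [cf] of that power of
    [1 - x] enter through the recursion given by its logarithmic derivative,
    to be compared with [anni_euler]. *)
Lemma anni_crea_ket eps del (cf : nat -> C) m (l : nat) k : cf 0%N = 1 ->
  (forall t, t.+1%:R * cf t.+1
     = - (2 * eps * del)%:~R * \sum_(s < t.+1) cf s) ->
  anni eps l (crea del k (ket m)) = cf l *: crea del (k - l%:Z) (ket m).
Proof.
move=> cf0 cfS; elim/ltn_ind: l k => -[|l] IHl k.
  by rewrite anni0 cf0 scale1r subr0.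
have l0 : l.+1%:R != 0 :> C by rewrite pnatr_eq0.
apply: (scalerI l0); rewrite anni_euler scalerA cfS.
transitivity (- (eps%:~R * sqrt2) *: \sum_(r < l.+1)
   (cf (l.+1 - r.+1)%N * (del%:~R * sqrt2)) *: crea del (k - l.+1%:Z) (ket m)).
  congr (_ *: _); apply: eq_bigr => r _; have rl := ltn_ord r.
  rewrite IHl; last by lia.
  rewrite (linfunZ _ (heis_linear _)) heis_crea heis_ket.
  rewrite (linfun0 (crea_linear _ _)) add0r scalerA.
  by congr (_ *: crea _ _ _); lia.
rewrite -scaler_suml scalerA -mulr_suml; congr (_ *: _).
have -> : \sum_(r < l.+1) cf (l.+1 - r.+1)%N = \sum_(r < l.+1) cf r.
  rewrite (reindex_inj rev_ord_inj); apply: eq_bigr => i _ /=.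
  by congr cf; have := ltn_ord i; lia.
rewrite !intrM !mulNr; congr (- _).
have := @sqrt2M C; rewrite -[2%:~R]/(2%:R); move: sqrt2 => t <-; ring.
Qed.

(** The Taylor coefficients of [(1 - x)^2] and of [(1 - x)^(-2)], with an integral
    index. *)
Definition binom2 (k : int) : C :=
  match k with Posz 0 => 1 | Posz 1 => - 2%:R | Posz 2 => 1 | _ => 0 end.

Definition binomN2 (k : int) : C := if k is Posz l then l.+1%:R else 0.

Lemma anni_crea_ket_same eps m (l : nat) k : eps * eps = 1 ->
  anni eps l (crea eps k (ket m)) = binom2 l *: crea eps (k - l%:Z) (ket m).
Proof.
move=> ee; apply: (anni_crea_ket (cf := fun l => binom2 l%:Z)) => // t.
rewrite -mulrA ee mulr1; case: t => [|[|t]].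
- by rewrite big_ord1 /=; ring.
- by rewrite !big_ord_recl big_ord0 /=; ring.
- by rewrite !big_ord_recl big1 // /=; ring.
Qed.

Lemma anni_crea_ket_opp eps m (l : nat) k : eps * eps = 1 ->
  anni eps l (crea (- eps) k (ket m)) = binomN2 l *: crea (- eps) (k - l%:Z) (ket m).
Proof.
move=> ee; apply: (anni_crea_ket (cf := fun l => binomN2 l%:Z)) => // t.
rewrite -mulrA mulrN ee mulrN1 mulrNz opprK /binomN2.
elim: t => [|t IHt]; first by rewrite big_ord1 mul1r mulr1.
by rewrite big_ord_recr [X in _ = X]mulrDr -IHt -!natr1; ring.
Qed.

Lemma exp_q_ket eps m : exp_q eps (ket m) = ket (m + eps) :> F.
Proof. exact: exp_q_basis. Qed.

Lemma homog_crea_ket eps k m : homog m k (crea eps k (ket m) : F).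
Proof. by have := homog_crea eps k (homog_ket m); rewrite add0r. Qed.
Arguments homog_crea_ket : clear implicits.

Lemma vop_ket eps n m :
  vop eps n (ket m) = crea eps (- n - 1 - 2 * eps * m) (ket (m + eps)) :> F.
Proof.
rewrite (@vopE _ eps n m 0 _ 1 (homog_ket m)) // big_ord1 anni0.
by rewrite exp_q_crea exp_q_ket; congr crea; rewrite /=; ring.
Qed.

Lemma vop_crea_ket eps del n m k (cf : int -> C) :
  (forall (l : nat) k, anni eps l (crea del k (ket m))
     = cf l *: crea del (k - l%:Z) (ket m)) ->
  (forall l : nat, cf (Negz l) = 0) ->
  k - n - 1 - 2 * eps * m = 0 ->
  vop eps n (crea del k (ket m)) = cf k *: ket (m + eps).
Proof.
move=> cfE cfN E.
case: k => k in E *; last first.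
  by rewrite cfN scale0r crea_lt0 // (linfun0 (vop_linear _ _)).
have kh := homog_crea_ket del k m.
rewrite (@vopE _ eps n m k _ k.+1 kh); last by lia.
rewrite big_ord_recr big1 /= => [|l _]; last first.
  rewrite crea_lt0 ?(linfun0 (exp_q_linear _)) //.
  by have := ltn_ord l; lia.
rewrite add0r cfE subrr !crea0.
have -> : k%:Z - n - 1 - 2 * eps * m = 0 by lia.
by rewrite crea0 (linfunZ _ (exp_q_linear _)) exp_q_ket.
Qed.

Lemma supp_inB S (u v : F) : supp_in S u -> supp_in S v -> supp_in S (u - v).
Proof. by move=> Su Sv; rewrite -scaleN1r; apply: supp_inD => //; apply: supp_inZ. Qed.

(** A family of homogeneous operators that is stable under bracketing with the
    [a_r] is determined by its coefficients from vacuum to vacuum: the [a_r]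
    with [r > 0] detect every vector of positive energy, and those with
    [r < 0] generate each Fock module from its vacuum. *)
Lemma family_vanishes (T : Type) (D : T -> F -> F) (e : T -> int) (s : int -> int)
    (c0 : int) :
  (forall t, linear (D t)) ->
  (forall t c d v, homog c d v -> homog (c + c0) (d + e t + s c) (D t v)) ->
  (forall r t v, (forall t', e t' = e t - r -> D t' v = 0) ->
     heis r (D t v) = D t (heis r v)) ->
  (forall t c, e t + s c = 0 -> D t (ket c) = 0) ->
  forall t v, D t v = 0.
Proof.
move=> lD hD aD D0.
have Dket c : forall (N : nat) t, e t + s c < N%:Z -> D t (ket c) = 0.
  elim=> [|N IHN] t tN; have h := hD t c 0 _ (homog_ket c).
    by apply: homog_lt0 h; rewrite add0r.
  have [lt0|gt0|/D0//] := ltgtP (e t + s c) 0.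
    by apply: homog_lt0 h; rewrite add0r.
  apply: (heis_kernel_homog _ h); first by rewrite add0r.
  move=> p; rewrite aD ?heis_ket ?(linfun0 (lD _)) // => t' et'.
  by apply: IHN; lia.
have Dbasis c mu : forall t, D t (fock_basis (c, mu)) = 0.
  elim/mset_ind: mu => [|p mu IHmu] t.
    by apply: (Dket c `|e t + s c|.+1 t); lia.
  rewrite -heis_neg_basis -aD => [|t' _]; last exact: IHmu.
  by rewrite IHmu (linfun0 (heis_linear _)).
move=> t; apply: (eq_on_basis (lD t) linear_zero) => -[c mu]; exact: Dbasis.
Qed.

End VacuumCoefficients.
Arguments homog_crea_ket {C} eps k m.

(** * Bracket relations *)

(** Linear identities between vectors, checked coefficientwise. *)
Local Ltac fock_ring :=
  apply/malgP => ?; rewrite !(mcoeffD, mcoeffN, mcoeffZ, mcoeff0);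
  repeat match goal with |- context [mcoeff ?b ?x] => move: (mcoeff b x) => ? end;
  ring.

Section Brackets.
Context {C : numClosedFieldType}.
Local Notation F := (Fock C).
Local Notation sqrt2 := (sqrtC (2%:R : C)).
Implicit Types (eps del m n r k c d : int) (u v w : F).

Let heisL n : linear (@heis C n) := @heis_linear C n.
Let vertL eps n : linear (@vop C eps n) := @vop_linear C eps n.

Lemma vertex_vertex_ket eps del n m c (cf : int -> C) :
  (forall (l : nat) k a, anni eps l (crea del k (ket a))
     = cf l *: crea del (k - l%:Z) (ket a)) ->
  (forall l : nat, cf (Negz l) = 0) ->
  n + m = - 2 - 2 * del * c - 2 * eps * (c + del) ->
  vop eps n (vop del m (ket c))
    = cf (- m - 1 - 2 * del * c) *: ket (c + del + eps).
Proof.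
move=> cfE cfN E; rewrite vop_ket.
by apply: vop_crea_ket => //; lia.
Qed.

Lemma heis_commutator_vertex eps del r n m v :
  heis r (commutator (vop eps n) (vop del m) v)
  = commutator (vop eps n) (vop del m) (heis r v)
    + (eps%:~R * sqrt2) *: commutator (vop eps (n + r)) (vop del m) v
    + (del%:~R * sqrt2) *: commutator (vop eps n) (vop del (m + r)) v.
Proof.
have heisVV e e' a b : heis r (vop e a (vop e' b v))
    = vop e a (vop e' b (heis r v))
      + (e'%:~R * sqrt2) *: vop e a (vop e' (b + r) v)
      + (e%:~R * sqrt2) *: vop e (a + r) (vop e' b v).
  rewrite (heis_vop r e a) (heis_vop r e' b).
  by rewrite (linfunD (vertL e a)) (linfunZ _ (vertL e a)).
rewrite /commutator (linfunB (heisL r)) !heisVV.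
set x1 := vop eps n _; set x2 := vop eps n _.
set x3 := vop eps _ _; set x4 := vop del m _.
set x5 := vop del m _; set x6 := vop del _ _.
move: x1 x2 x3 x4 x5 x6 => x1 x2 x3 x4 x5 x6.
fock_ring.
Qed.

Lemma homog_vertex_vertex eps del n m c d v : homog c d v ->
  homog (c + (eps + del))
    (d + (- n - m) + (- 2 - 2 * del * c - 2 * eps * (c + del)))
    (vop eps n (vop del m v)).
Proof.
move=> vh; have := homog_vop eps n (homog_vop del m vh).
by congr (homog _ _ _); ring.
Qed.

Arguments homog_vertex_vertex eps del n m {c d v}.

(** For both orders of the product the vacuum coefficients are those of
    [(1 - x)^2], read in opposite directions, and [1, -2, 1] is symmetric. *)
Lemma vertex_same_commute eps n m v : eps * eps = 1 ->
  commutator (vop eps n) (vop eps m) v = 0.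
Proof.
move=> ee.
pose D (t : int * int) := commutator (@vop C eps t.1) (vop eps t.2).
apply: (@family_vanishes _ _ D (fun t => - t.1 - t.2)
   (fun c => - 2 - 2 * eps * c - 2 * eps * (c + eps)) (eps + eps) _ _ _ _ (n, m)).
- by move=> t; apply: linear_commutator.
- move=> t c d w wh; apply: supp_inB; first exact: homog_vertex_vertex.
  have := homog_vertex_vertex eps eps t.2 t.1 wh.
  by congr (homog _ _ _); ring.
- move=> r [a b] w /= D0; rewrite /D heis_commutator_vertex.
  have Z1 : commutator (vop eps (a + r)) (vop eps b) w = 0.
    by apply: (D0 (a + r, b)); rewrite /=; ring.
  have Z2 : commutator (vop eps a) (vop eps (b + r)) w = 0.
    by apply: (D0 (a, b + r)); rewrite /=; ring.
  by rewrite Z1 Z2 scaler0 !addr0.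
- move=> [a b] c /= E; rewrite /D /commutator /=.
  have same := @anni_crea_ket_same C eps.
  rewrite !(@vertex_vertex_ket eps eps _ _ _ (@binom2 C)) //;
    try (by move=> *; apply: same); try lia.
  rewrite -scalerBl; apply/eqP; rewrite scaler_eq0; apply/orP; left.
  have -> : - b - 1 - 2 * eps * c = 2 - (- a - 1 - 2 * eps * c).
    have h : 2 * eps * (c + eps) = 2 * eps * c + 2.
      by rewrite mulrDr -(mulrA 2 eps eps) ee mulr1.
    by rewrite h in E; move: (2 * eps * c) E => y; lia.
  rewrite subr_eq0; case: (- a - 1 - 2 * eps * c) => [[|[|[|k]]]|k] //.
Qed.

(** The vacuum coefficients of the two orders are those of [(1 - x)^(-2)] at [k]
    and at [- k - 2]. Their difference is [k + 1] for every integer [k], and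
    this is the sum of the eigenvalue of [h_0] and of the central term. *)
Lemma vertex_pm_commutator n m v :
  commutator (vop 1 n) (vop (-1) m) v
  = sqrt2 *: heis (n + m) v + (if n == - m then n else 0)%:~R *: v.
Proof.
apply/eqP; rewrite -subr_eq0; apply/eqP.
pose D (t : int * int) v : F := commutator (vop 1 t.1) (vop (-1) t.2) v
  - (sqrt2 *: heis (t.1 + t.2) v + (if t.1 == - t.2 then t.1 else 0)%:~R *: v).
apply: (@family_vanishes _ _ D (fun t => - t.1 - t.2) (fun c => 0) 0 _ _ _ _ (n, m)).
- move=> t; apply: linear_sub; first exact: linear_commutator.
  by apply: linear_add; apply: linear_scale.
- move=> [a b] c d w wh; rewrite /D /=; apply: supp_inB; last first.
    apply: supp_inD.
      apply: supp_inZ; have := homog_heis (a + b) wh.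
      by congr (homog _ _ _); ring.
    case: eqP => [->|_]; last by rewrite scale0r; exact: supp_in0.
    by apply: supp_inZ; have := wh; congr (homog _ _ _); ring.
  apply: supp_inB.
    by have := homog_vertex_vertex 1 (-1) a b wh; congr (homog _ _ _); ring.
  by have := homog_vertex_vertex (-1) 1 b a wh; congr (homog _ _ _); ring.
- move=> r [a b] w /= D0.
  have /eqP := D0 (a + r, b) (ltac:(rewrite /=; ring)).
  rewrite subr_eq0 /= => /eqP D1.
  have /eqP := D0 (a, b + r) (ltac:(rewrite /=; ring)).
  rewrite subr_eq0 /= => /eqP D2.
  rewrite /D /= (linfunB (heisL r)).
  rewrite heis_commutator_vertex D1 D2 (linfunD (heisL r)) !(linfunZ _ (heisL r)).
  have -> : heis r (heis (a + b) w) = heis (a + b) (heis r w)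
      + (if r == - (a + b) then r%:~R else 0) *: w.
    by rewrite -heis_commutator /commutator [RHS]addrC subrK.
  have -> : (a + r == - b) = (r == - (a + b)) by apply/eqP/eqP; lia.
  have -> : (a == - (b + r)) = (r == - (a + b)) by apply/eqP/eqP; lia.
  rewrite [a + r + b]addrAC [a + (b + r)]addrA.
  set x := commutator _ _ _; set y := heis (_ + _) (heis _ _).
  set z := heis (_ + _) w; set t := heis r w.
  move: x y z t => x y z t.
  rewrite -[1%:~R]/(1 : C) -[(-1)%:~R]/(-1 : C).
  case: eqP => [rE|_]; last by fock_ring.
  by rewrite intrD; fock_ring.
- move=> [a b] c /= E; rewrite /D /commutator /=.
  have opp1 := @anni_crea_ket_opp C 1; have opp2 := @anni_crea_ket_opp C (-1).
  rewrite opprK in opp2.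
  rewrite !(@vertex_vertex_ket _ _ _ _ _ (@binomN2 C)) //;
    try (by move=> *; first [apply: opp1|apply: opp2]); try lia.
  have -> : c + -1 + 1 = c by ring.
  have -> : c + 1 - 1 = c by ring.
  have bE : b = - a by lia.
  rewrite bE opprK eqxx subrr /ket heis0_basis; set k := a - 1 - 2 * -1 * c.
  have -> : - a - 1 - 2 * 1 * c = - k - 2 by rewrite /k; ring.
  rewrite scalerA -scalerDl -!scalerBl mulrCA sqrt2M.
  rewrite [X in X *: _](_ : _ = 0) ?scale0r //.
  have -> : c%:~R * 2%:R + a%:~R = (k + 1)%:~R :> C.
    by rewrite -[2%:R]/(2%:~R) -intrM -intrD; congr (_%:~R); rewrite /k; ring.
  case: k => [k|[|k]].
  - have -> : - k%:Z - 2 = Negz k.+1 by lia.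
    by rewrite /binomN2 subr0 -PoszD addn1 subrr.
  - have -> : - Negz 0 - 2 = Negz 0 by lia.
    have -> : Negz 0 + 1 = 0 by lia.
    by rewrite /binomN2 !subr0.
  - have -> : - Negz k.+1 - 2 = k by lia.
    have -> : Negz k.+1 + 1 = - k.+1%:Z by lia.
    by rewrite /binomN2 mulrNz opprK sub0r addNr.
Qed.

End Brackets.
Arguments homog_vertex_vertex {C} eps del n m {c d v}.

Section CreationCommutation.
Context {C : numClosedFieldType}.
Local Notation F := (Fock C).
Local Notation sqrt2 := (sqrtC (2%:R : C)).
Implicit Types (eps del m n r k c d : int) (u v w : F).

Let heisL n : linear (@heis C n) := @heis_linear C n.
Let vertL eps n : linear (@vop C eps n) := @vop_linear C eps n.
Let creaL eps k : linear (@crea C eps k) := @crea_linear C eps k.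

Lemma crea_crea_ket i j m : i + j = 0 ->
  crea 1 i (crea 1 j (ket m)) = (i == 0)%:R *: ket m :> F.
Proof.
move=> ij; have [i0|ij0] := eqVneq i 0.
  have j0 : j = 0 by lia.
  by rewrite i0 j0 !crea0 scale1r.
rewrite scale0r; have [ilt0|] := ltP i 0; first exact: crea_lt0.
by move=> ige0; rewrite (@crea_lt0 _ 1 j) ?(linfun0 (creaL _ _)) //; lia.
Qed.

(** Moving [e(z)] past the creation part [P(w)] multiplies by [(1 - w/z)^2],
    the factor by which its annihilation part acts on [P(w)]. *)
Lemma vop_crea n k v : vop 1 n (crea 1 k v) = crea 1 k (vop 1 n v)
  - 2%:R *: crea 1 (k - 1) (vop 1 (n - 1) v) + crea 1 (k - 2) (vop 1 (n - 2) v).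
Proof.
apply/eqP; rewrite -subr_eq0; apply/eqP.
pose D (t : int * int) v : F := vop 1 t.1 (crea 1 t.2 v)
  - (crea 1 t.2 (vop 1 t.1 v) - 2%:R *: crea 1 (t.2 - 1) (vop 1 (t.1 - 1) v)
     + crea 1 (t.2 - 2) (vop 1 (t.1 - 2) v)).
apply: (@family_vanishes _ _ D (fun t => t.2 - t.1)
   (fun c => - 1 - 2 * 1 * c) 1 _ _ _ _ (n, k)).
- have cv a b : linear (crea 1 a \o @vop C 1 b) by apply: linear_comp.
  move=> [a b]; apply: linear_sub; first exact: (linear_comp (vertL 1 a) (creaL 1 b)).
  apply: linear_add; last exact: cv.
  by apply: linear_sub; [exact: cv|apply: linear_scale; exact: cv].
- move=> [a b] c d w wh.
  have cvh i j : i - j = b - a ->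
      homog (c + 1) (d + (b - a) + (- 1 - 2 * 1 * c)) (crea 1 i (vop 1 j w)).
    move=> E; have := homog_crea 1 i (homog_vop 1 j wh); rewrite -E.
    by congr (homog _ _ _); ring.
  rewrite /D /=; apply: supp_inB.
    have := homog_vop 1 a (homog_crea 1 b wh).
    by congr (homog _ _ _); ring.
  apply: supp_inD; last by apply: cvh; ring.
  by apply: supp_inB; [apply: cvh|apply: supp_inZ; apply: cvh; ring].
- move=> r [a b] w /= D0.
  have /eqP := D0 (a + r, b) (ltac:(rewrite /=; ring)).
  rewrite subr_eq0 /= => /eqP D1.
  have /eqP := D0 (a, b - r) (ltac:(rewrite /=; ring)).
  rewrite subr_eq0 /= => /eqP D2.
  pose al : C := 1%:~R * sqrt2; pose be : C := if 0 < r then al else 0.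
  have cv i j : heis r (crea 1 i (vop 1 j w)) = crea 1 i (vop 1 j (heis r w))
     + al *: crea 1 i (vop 1 (j + r) w) + be *: crea 1 (i - r) (vop 1 j w).
    by rewrite heis_crea heis_vop (linfunD (creaL 1 i)) (linfunZ _ (creaL 1 i)).
  rewrite /D /= (linfunB (heisL r)) (linfunD (heisL r)) (linfunB (heisL r)).
  rewrite (linfunZ _ (heisL r)) !cv.
  rewrite heis_vop heis_crea D1 (linfunD (vertL 1 a)) (linfunZ _ (vertL 1 a)) D2.
  rewrite -/al -/be.
  have -> : a - 1 + r = a + r - 1 by ring.
  have -> : a - 2 + r = a + r - 2 by ring.
  have -> : b - 1 - r = b - r - 1 by ring.
  have -> : b - 2 - r = b - r - 2 by ring.
  move: al be {cv D1 D2 D0 D} => al be.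
  repeat match goal with |- context [crea ?e ?i ?x] => move: (crea e i x) => ? end.
  by move: (vop _ _ _) => ?; fock_ring.
- move=> [a b] c /= E; rewrite /D /=.
  rewrite (@vop_crea_ket C 1 1 a c b (@binom2 C)) //; last by lia.
    rewrite !vop_ket !crea_crea_ket; try lia.
    rewrite !subr_eq0 scalerA -scalerBl -scalerDl -scalerBl.
    rewrite [X in X *: _](_ : _ = 0) ?scale0r //.
    by case: b {E} => [[|[|[|b]]]|b] //=; ring.
  by move=> l j; apply: anni_crea_ket_same.
Qed.

End CreationCommutation.

(** * The module structure and its irreducibility *)

Section FockModule.
Context {C : numClosedFieldType}.
Local Notation F := (Fock C).
Local Notation sqrt2 := (sqrtC (2%:R : C)).
Implicit Types (eps m n c d : int) (v w : F).

Let heisL n : linear (@heis C n) := @heis_linear C n.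
Let vertL eps n : linear (@vop C eps n) := @vop_linear C eps n.

Lemma act_eE n : act_e (@fock_ops C) n = vop 1 n.
Proof. by rewrite vop.unlock. Qed.

Lemma act_fE n : act_f (@fock_ops C) n = vop (-1) n.
Proof. by rewrite vop.unlock. Qed.

Lemma fock_affine_module : is_affine_module (@fock_ops C).
Proof.
have hv eps n m v : commutator (act_h fock_ops n) (vop eps m) v
    = (2%:R * eps%:~R) *: vop eps (n + m) v.
  rewrite /commutator /= heis_vop (linfunZ _ (vertL eps m)) scalerDr addrAC subrr.
  by rewrite add0r scalerA mulrCA sqrt2M mulrC [n + m]addrC.
split=> [n|n|n||n m v|n m v|n m v|n m v|n m v|n m v|n v|n v|n v];
  rewrite ?act_eE ?act_fE.
- exact: vertL.
- exact: vertL.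
- exact/linear_scale/heisL.
- by [].
- exact: vertex_same_commute.
- exact: vertex_same_commute.
- exact: vertex_pm_commutator.
- by rewrite hv mulr1.
- by rewrite hv mulrN1 scaleNr.
- rewrite /commutator /= !(linfunZ _ (heisL _)) -!scalerBr.
  rewrite -/(commutator (heis n) (heis m) v) heis_commutator !scalerA sqrt2M.
  by case: eqP; rewrite ?mulr0.
- exact: subrr.
- exact: subrr.
- exact: subrr.
Qed.

Lemma vop1_ket m : vop 1 (- 2 * m - 1) (ket m) = ket (m + 1) :> F.
Proof.
by rewrite vop_ket (_ : _ - 2 * 1 * m = 0) ?crea0 //; ring.
Qed.

Lemma vopN1_ket m : vop (-1) (2 * m - 1) (ket m) = ket (m - 1) :> F.
Proof.
by rewrite vop_ket (_ : _ - 2 * -1 * m = 0) ?crea0 //; ring.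
Qed.

Section Submodule.
Variable W : F -> Prop.
Hypothesis Wsub : is_submodule fock_ops W.

Lemma submodZ (c : C) v : W v -> W (c *: v).
Proof.
move=> Wv; rewrite -[_ *: _]addr0; apply: (sub_lin Wsub) => //.
exact: (sub_zero Wsub).
Qed.

Lemma submodD v w : W v -> W w -> W (v + w).
Proof. by move=> Wv Ww; rewrite -[v]scale1r; exact: (sub_lin Wsub). Qed.

Lemma submod_heis n v : W v -> W (heis n v).
Proof.
move=> Wv; have -> : heis n v = sqrt2^-1 *: act_h fock_ops n v.
  by rewrite /= scalerA mulVf ?scale1r // sqrt2_neq0.
exact/submodZ/(sub_h Wsub).
Qed.

(** The modes [e_(-2m-1)] and [f_(2m-1)] move between the vacua, and the
    creation operators fill each Fock module from its vacuum. *)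
Lemma submod_full m : W (ket m) -> forall v, W v.
Proof.
move=> Wm.
have up k : W (ket k) -> W (ket (k + 1)).
  by move=> Wk; rewrite -vop1_ket -act_eE; apply: (sub_e Wsub).
have down k : W (ket k) -> W (ket (k - 1)).
  by move=> Wk; rewrite -vopN1_ket -act_fE; apply: (sub_f Wsub).
have Wup (N : nat) : W (ket (m + N%:Z)).
  elim: N => [|N IHN]; first by rewrite addr0.
  by rewrite -addn1 PoszD addrA; exact: up.
have Wdown (N : nat) : W (ket (m - N%:Z)).
  elim: N => [|N IHN]; first by rewrite subr0.
  by rewrite -addn1 PoszD opprD addrA; exact: down.
have Wket k : W (ket k).
  have [mk|km] := leP m k.
    by have := Wup `|k - m|%N; congr (W (ket _)); lia.
  by have := Wdown `|k - m|%N; congr (W (ket _)); lia.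
have Wbasis k mu : W (fock_basis (k, mu)).
  elim/mset_ind: mu => [|p mu IHmu]; first exact: Wket.
  by rewrite -heis_neg_basis; exact: submod_heis.
move=> v; rewrite [v]fock_expand; elim/big_ind: _.
- exact: (sub_zero Wsub).
- exact: submodD.
- by move=> [k mu] _; exact: submodZ.
Qed.

(** Induction on the energy: either some [a_r] with [r > 0] gives a nonzero
    vector of lower energy, or only vacua are left. *)
Lemma submod_lower (N : nat) v : W v -> v != 0 ->
  supp_in (fun b => (energy b.2 < N)%N) v ->
  exists w, [/\ W w, w != 0 & supp_in (fun b => b.2 = mset0) w].
Proof.
elim: N v => [|N IHN] v Wv v0 vN.
  case/eqP: v0; apply/malgP => b; rewrite mcoeff0.
  by apply/eqP/negPn/negP => /vN.
have [vk|] := pselect (forall p : nat, heis p.+1%:Z v = 0).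
  by exists v; split => //; exact: heis_kernel.
move=> /existsNP[p /eqP hv0]; apply: (IHN (heis p.+1%:Z v)) => //.
  exact: submod_heis.
move=> [m mu]; rewrite mcoeff_heis_pos mulf_eq0 negb_or => /andP[_ /vN] /=.
by rewrite energy1D; lia.
Qed.

(** Distinct vacua have distinct eigenvalues for [h_0], so a combination of
    vacua of minimal length is a single one. *)
Lemma submod_ket (N : nat) w : W w -> w != 0 ->
  supp_in (fun b => b.2 = mset0) w -> (size (msupp w) <= N)%N ->
  exists m, W (ket m).
Proof.
elim: N w => [|N IHN] w Ww w0 wk sw.
  case/eqP: w0; apply/malgP => b; rewrite mcoeff0 mcoeff_outdom //.
  by move: sw; rewrite leqn0 cardfs_eq0 => /eqP ->; rewrite in_fset0.
have [b bw] : exists b, b \in msupp w.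
  apply: contrapT => /forallNP nb; case/eqP: w0; apply/malgP => b.
  by rewrite mcoeff0 mcoeff_outdom //; apply/negP/nb.
pose w' := heis 0 w - (b.1%:~R * sqrt2) *: w.
have cw' (a : fock_index) :
    mcoeff a w' = ((a.1 - b.1)%:~R * sqrt2) * mcoeff a w.
  by rewrite mcoeffB mcoeffZ mcoeff_heis0 -mulrBl -mulrBl -intrB.
have Ww' : W w'.
  by rewrite /w' -scaleNr; apply: submodD; [exact: submod_heis|exact: submodZ].
have [w'0|w'0] := eqVneq w' 0; last first.
  apply: (IHN w') => // [a|].
    by rewrite cw' mulf_eq0 negb_or => /andP[_ /wk].
  have sub : (msupp w' `<=` msupp w `\ b)%fset.
    apply/fsubsetP => a; rewrite -mcoeff_neq0 cw' !inE mulf_eq0 negb_or.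
    rewrite mcoeff_neq0 => /andP[nz ->]; rewrite andbT.
    by apply: contraNneq nz => ->; rewrite subrr mul0r.
  have := fsubset_leq_card sub; have := cardfsD1 b (msupp w); rewrite bw add1n.
  by move: sw => sw E /leq_trans; apply; rewrite -ltnS -E.
exists b.1; have wE : w = mcoeff b w *: ket b.1.
  apply/malgP => a; rewrite mcoeffZ mcoeff_basis.
  have bk : b = (b.1, mset0) by rewrite -(wk b) ?mcoeff_neq0 //; case: (b).
  rewrite -bk; have [<-|ba] := eqVneq b a; first by rewrite mulr1.
  rewrite mulr0; apply/eqP; apply: contraNT ba => aw.
  have := cw' a; rewrite w'0 mcoeff0 => /esym/eqP.
  rewrite !mulf_eq0 (negbTE aw) (negbTE sqrt2_neq0) !orbF intr_eq0 subr_eq0.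
  by move=> /eqP ab; rewrite bk -ab -(wk a aw); case: (a).
have := submodZ (mcoeff b w)^-1 Ww.
by rewrite [X in _ *: X]wE scalerA mulVf ?scale1r // mcoeff_neq0.
Qed.

End Submodule.

Lemma ket_neq0 m : ket m != 0 :> F.
Proof.
apply/eqP => /(congr1 (mcoeff ((m, mset0) : fock_index))) /eqP.
by rewrite mcoeff_basis eqxx mcoeff0 oner_eq0.
Qed.

Lemma fock_irreducible : is_irreducible (@fock_ops C).
Proof.
split; first by exists (ket 0); apply/eqP; exact: ket_neq0.
move=> W Wsub.
have [W0|/existsNP[v /not_implyP[Wv /eqP v0]]] :=
  pselect (forall v, W v -> v = 0); [by left|right].
(* A strict bound on the energies occurring in [v]. *)
pose N := (\max_(b <- msupp v) energy b.2).+1.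
have vN : supp_in (fun b => (energy b.2 < N)%N) v.
  move=> b; rewrite mcoeff_neq0 => bv; rewrite /N ltnS.
  by rewrite (big_rem b bv) /=; exact: leq_maxl.
have [w [Ww w0 wk]] := submod_lower Wsub Wv v0 vN.
have [m Wm] := submod_ket Wsub Ww w0 wk (leqnn _).
exact: submod_full Wm.
Qed.

Theorem fock_is_L01 : is_L (@fock_ops C) 0 1 (ket 0).
Proof.
split.
- exact: fock_affine_module.
- exact: fock_irreducible.
- by move=> W Wsub W0; exact: submod_full W0.
- split; first by rewrite act_eE vop_ket crea_lt0.
  case=> [[|k]|k] // _; split.
  + by rewrite act_eE vop_ket crea_lt0 //; lia.
  + by rewrite act_fE vop_ket crea_lt0 //; lia.
  + by rewrite /= heis_ket scaler0.
- by rewrite /= /ket heis0_basis mul0r scale0r scaler0.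
- by rewrite scale1r.
Qed.

(** * The value of a semi-infinite monomial *)

Lemma has_tailS (i : nat -> int) N j : has_tail i N j -> has_tail i N.+1 (j - 1).
Proof. by move=> ht r; have := ht r.+1; rewrite addSnnS => ->; lia. Qed.

(** The next factor of the tail, [e_(-2j+1)], maps [|(j-1) sqrt2>] to
    [|j sqrt2>]. *)
Lemma finite_monomialS (i : nat -> int) N j : has_tail i N j ->
  finite_monomial i N.+1 (ket (j - 1)) = finite_monomial i N (ket j) :> F.
Proof.
move=> ht; have e1 : act_e fock_ops (i N) (ket (j - 1)) = ket j :> F.
  rewrite act_eE -[N]addn0 ht.
  have -> : - (2 * j) + (2 * 1)%:Z - 1 = - 2 * (j - 1) - 1 by ring.
  by rewrite vop1_ket subrK.
rewrite /finite_monomial -addn1 iotaD foldr_cat add0n.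
by congr (foldr _ _ _); exact: e1.
Qed.

Lemma finite_monomial_unique (i : nat -> int) N j N' j' :
  has_tail i N j -> has_tail i N' j' ->
  finite_monomial i N (ket j) = finite_monomial i N' (ket j') :> F.
Proof.
wlog NN' : N j N' j' / (N <= N')%N => [wh ht ht'|ht ht'].
  by case/orP: (leq_total N N') => le; [exact: wh|symmetry; exact: wh].
have tail (d : nat) : has_tail i (N + d)%N (j - d%:Z) /\
    finite_monomial i (N + d)%N (ket (j - d%:Z)) = finite_monomial i N (ket j) :> F.
  elim: d => [|d [IHt IHm]]; first by rewrite addn0 subr0.
  rewrite -IHm addnS -(finite_monomialS IHt).
  have -> : j - d.+1%:Z = j - d%:Z - 1 by lia.
  by split=> //; exact: has_tailS.
have := tail (N' - N)%N; rewrite subnKC // => -[t <-].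
have := t 0%N; have := ht' 0%N; rewrite addn0 => -> E.
by congr (finite_monomial _ _ (ket _)); lia.
Qed.

Lemma semi_infinite_monomialE (i : nat -> int) N j : has_tail i N j ->
  semi_infinite_monomial C i = finite_monomial i N (ket j).
Proof.
move=> ht; rewrite /semi_infinite_monomial.
set P := (X in xget _ X); have : P (xget (0%N, 0 : int) P).
  by apply: (@xgetPex _ (0%N, 0 : int) P); exists (N, j).
by move=> /finite_monomial_unique; apply.
Qed.

End FockModule.

(** * Unitriangular changes of basis *)

Section Triangular.
Context {C : numClosedFieldType}.
Local Notation F := (Fock C).
Variables (u : fock_index -> F) (G : Type) (grade : fock_index -> G).
Variables (rank : fock_index -> nat) (bound : G -> nat).
Implicit Types (a b : fock_index) (v : F).

Hypothesis u_diag : forall b, mcoeff b (u b) != 0.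
Hypothesis u_above : forall b a, mcoeff a (u b) != 0 ->
  a = b \/ (grade a = grade b /\ (rank b < rank a)%N).
Hypothesis rank_bound : forall b, (rank b <= bound (grade b))%N.

(** A vector in the kernel has zero coefficients, by induction on the rank: only
    indices of smaller rank contribute off the diagonal. *)
Lemma triangular_injective v : linear_extension u v = 0 -> v = 0.
Proof.
move=> Lv0; have vb n : forall b, (rank b < n)%N -> mcoeff b v = 0.
  elim: n => // n IHn b bn; apply/eqP/negPn/negP => vb.
  have := congr1 (mcoeff b) Lv0; rewrite mcoeff0 /linear_extension mcoeff_sum.
  rewrite (bigD1_seq b) ?fset_uniq -?mcoeff_neq0 //= big1 => [|a ab].
    by rewrite mcoeffZ addr0 => /eqP; rewrite mulf_eq0 (negbTE vb) (negbTE (u_diag b)).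
  rewrite mcoeffZ; have [->|/u_above] := eqVneq (mcoeff b (u a)) 0.
    by rewrite mulr0.
  case=> [ba|[_ ra]]; first by rewrite ba eqxx in ab.
  by rewrite IHn ?mul0r //; lia.
by apply/malgP => b; rewrite mcoeff0; apply: (vb (rank b).+1).
Qed.

(** The ranks are bounded on each graded piece, so basis vectors are reached by
    descending induction on the rank. *)
Lemma triangular_surjective v : exists x, linear_extension u x = v.
Proof.
pose Im (w : F) := exists x, linear_extension u x = w.
have lL := linear_extension_linear u.
have Im0 : Im 0 by exists 0; rewrite (linfun0 lL).
have ImD w w' : Im w -> Im w' -> Im (w + w').
  by move=> [x <-] [y <-]; exists (x + y); rewrite (linfunD lL).
have ImZ c w : Im w -> Im (c *: w).
  by move=> [x <-]; exists (c *: x); rewrite (linfunZ _ lL).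
have Im_supp (S : fock_index -> Prop) w : supp_in S w ->
    (forall b, S b -> Im (fock_basis b)) -> Im w.
  move=> Sw ImS; rewrite [w]fock_expand big_seq_cond.
  elim/big_ind: _ => // b /andP[bw _]; apply/ImZ/ImS/Sw.
  by rewrite mcoeff_neq0.
suff Imb n : forall b, (bound (grade b) - rank b < n)%N -> Im (fock_basis b).
  apply: (Im_supp (fun _ => True)) => // b _.
  exact: (Imb (bound (grade b) - rank b).+1).
elim: n => // n IHn b bn.
have ub := u_diag b.
have -> : fock_basis b = (mcoeff b (u b))^-1 *:
    (u b + (-1) *: (u b - mcoeff b (u b) *: fock_basis b)).
  by rewrite scaleN1r opprB addrC subrK scalerA mulVf ?scale1r.
apply: (ImZ); apply: ImD.
  by exists (fock_basis b); rewrite linear_extension_basis.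
apply: ImZ; apply: (Im_supp (fun a => grade a = grade b /\ (rank b < rank a)%N)).
  move=> a; rewrite mcoeffB mcoeffZ mcoeff_basis.
  have [<-|ba] := eqVneq b a; first by rewrite mulr1 subrr eqxx.
  by rewrite mulr0 subr0 => /u_above[ab|//]; rewrite ab eqxx in ba.
move=> a [ga ra]; apply: IHn; rewrite ga.
by have := rank_bound a; rewrite ga; lia.
Qed.

End Triangular.

(** * Products of the coefficients of the creation part *)

Section CreationProducts.
Context {C : numClosedFieldType}.
Local Notation F := (Fock C).
Local Notation sqrt2 := (sqrtC (2%:R : C)).
Local Open Scope mset_scope.
Implicit Types (m k : int) (p : nat) (mu : {mset nat}) (v w : F) (s t : seq int).

Let creaL eps k : linear (@crea C eps k) := @crea_linear C eps k.

Definition crea_prod m s : F := foldr (crea 1) (ket m) s.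

Lemma crea_prod_perm m s t : perm_eq s t -> crea_prod m s = crea_prod m t.
Proof.
have cat_cons k s1 s2 : crea_prod m (s1 ++ k :: s2) = crea 1 k (crea_prod m (s1 ++ s2)).
  by elim: s1 => //= x s1 IHs; rewrite /crea_prod /= -/(crea_prod _ _) IHs creaC.
elim: s t => [|k s IHs] t st; first by case: t st => // ? ? /perm_size.
have kt : k \in t by rewrite -(perm_mem st) mem_head.
case/splitPr: kt st => t1 t2 st; rewrite cat_cons /crea_prod /= -/(crea_prod _ _).
congr crea; apply: IHs; rewrite -(perm_cons k) (perm_trans st) //.
by rewrite perm_catC /= perm_cons perm_catC.
Qed.

Lemma crea_prod_lt0 m s : ~~ all (>= 0) s -> crea_prod m s = 0.
Proof.
elim: s => //= k s IHs; rewrite negb_and => /orP[kn|/IHs s0].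
  by rewrite /crea_prod /= crea_lt0 // ltNge.
by rewrite /crea_prod /= -/(crea_prod _ _) s0 (linfun0 (creaL _ _)).
Qed.

Lemma crea_prod_filter m s : all (>= 0) s ->
  crea_prod m s = crea_prod m [seq k <- s | 0 < k].
Proof.
elim: s => //= k s IHs /andP[k0 /IHs sE].
have [k0'|] := ltP 0 k; first by rewrite /crea_prod /= -!/(crea_prod _ _) sE.
move=> k0'; have -> : k = 0 by lia.
by rewrite /crea_prod /= crea0.
Qed.

Let part_supp m (d k : nat) (b : fock_index) :=
  [/\ b.1 = m, energy b.2 = d & (k <= size (enum_mset b.2))%N].

Let heis_part_supp m (d k : nat) p v : supp_in (part_supp m d k) v ->
  supp_in (part_supp m (d + p.+1) k.+1) (heis (- p.+1%:Z) v).
Proof.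
apply: supp_in_linear; first exact: heis_linear.
move=> [m' mu] [/= -> <- kmu]; rewrite heis_neg_basis; apply: supp_in_basis.
by split=> //=; rewrite ?energy1D ?size_mset1D // addnC.
Qed.

(** The linear term of the exponential contributes [a_(-p-1)]; the terms of
    degree [j >= 2] contribute products of [j] creation operators. *)
Let crea_lead m (d k : nat) p v : supp_in (part_supp m d k) v ->
  supp_in (part_supp m (d + p.+1) k.+2)
    (crea 1 p.+1 v - (sqrt2 / p.+1%:R) *: heis (- p.+1%:Z) v).
Proof.
move=> vs; rewrite creaE /creation_coef.
set x := (X in exp_coef X).
have lx r : linear (x r) by exact/linear_scale/phi_coef_linear.
have xpE : x p.+1 v = (sqrt2 / p.+1%:R) *: heis (- p.+1%:Z) v.
  by rewrite /x /phi_coef mul1r scalerA mulrNz opprK.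
rewrite -xpE /exp_coef big_ord_recl big_ord_recl.
rewrite (pow_coef1 lx) /= scaler0 add0r invr1 scale1r addrAC subrr add0r.
apply: supp_in_sum => j _; apply: supp_inZ.
pose S j n := part_supp m (d + n) (k + j).
have := @supp_in_pow_coef _ x S j.+2 p.+1 v.
rewrite /S addn0 addn0 => H; apply: (supp_in_sub _ (H _ vs)).
  by move=> b [? ? ?]; split=> //; lia.
move=> r i n w ws; rewrite addnA (addnS k).
by apply: supp_inZ; apply: supp_inZ; exact: heis_part_supp.
Qed.

(** One factor at a time, by [crea_lead]. *)
Lemma crea_prod_lead m (ps : seq nat) (mu := seq_mset ps) :
  exists2 c : C, c != 0 & supp_in (part_supp m (energy mu) (size ps).+1)
    (crea_prod m [seq p.+1%:Z | p <- ps] - c *: fock_basis (m, mu)).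
Proof.
rewrite {}/mu; elim: ps => [|p ps [c c0 IH]].
  exists 1; rewrite ?oner_eq0 // seq_mset_nil scale1r subrr; exact: supp_in0.
have cp : sqrt2 / p.+1%:R != 0 :> C.
  by rewrite mulf_neq0 ?sqrt2_neq0 ?invr_eq0 ?pnatr_eq0.
exists (c * (sqrt2 / p.+1%:R)); first exact: mulf_neq0.
rewrite mset_cons energy1D addnC; set mu := seq_mset ps.
set v := crea_prod m _ in IH; rewrite /crea_prod /= -/(crea_prod _ _) -/v.
have vE : v = c *: fock_basis (m, mu) + (v - c *: fock_basis (m, mu)).
  by rewrite addrC subrK.
set w := v - _ in IH vE.
have b_supp : supp_in (part_supp m (energy mu) (size ps)) (fock_basis (m, mu) : F).
  apply: supp_in_basis; split=> //=.
  by rewrite (perm_size (perm_eq_seq_mset ps)).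
rewrite vE (linfunD (creaL 1 _)) (linfunZ _ (creaL 1 _)) -scalerA.
rewrite addrAC -scalerBr; apply: supp_inD.
  by apply: supp_inZ; rewrite -heis_neg_basis; exact: crea_lead.
rewrite -[crea 1 _ w](subrK ((sqrt2 / p.+1%:R) *: heis (- p.+1%:Z) w)).
apply: supp_inD; last by apply: supp_inZ; exact: heis_part_supp.
by apply: (supp_in_sub _ (crea_lead IH)) => b [? ? /ltnW].

Qed.

(** The vectors [h_lambda] that play the role of products of complete symmetric
    functions, [lambda] being encoded by the multiset of its parts minus 1. *)
Definition crea_basis (b : fock_index) : F :=
  crea_prod b.1 [seq p.+1%:Z | p <- enum_mset b.2].

Let crea_basis_lead b : exists2 c : C, c != 0 &
  supp_in (part_supp b.1 (energy b.2) (size (enum_mset b.2)).+1)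
    (crea_basis b - c *: fock_basis b).
Proof.
case: b => m mu; have := crea_prod_lead m (enum_mset mu).
by rewrite seq_mset_id.
Qed.

Let crea_basis_diag b : mcoeff b (crea_basis b) != 0.
Proof.
have [c c0 h] := crea_basis_lead b; apply/eqP => b0.
have [] := h b; last by rewrite ltnn.
by rewrite mcoeffB b0 mcoeffZ mcoeff_basis eqxx mulr1 sub0r oppr_eq0.
Qed.

Let crea_basis_above b a : mcoeff a (crea_basis b) != 0 ->
  a = b \/ ((a.1, energy a.2) = (b.1, energy b.2) /\
     (size (enum_mset b.2) < size (enum_mset a.2))%N).
Proof.
have [c c0 h] := crea_basis_lead b => a0.
have [->|ab] := eqVneq a b; [by left|right].
have [|-> -> //] := h a.
by rewrite mcoeffB mcoeffZ mcoeff_basis (eq_sym b) (negbTE ab) mulr0 subr0.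
Qed.

Lemma crea_basis_injective v : linear_extension crea_basis v = 0 -> v = 0.
Proof.
exact: (triangular_injective crea_basis_diag crea_basis_above).
Qed.

Lemma crea_basis_surjective v : exists w, linear_extension crea_basis w = v.
Proof.
apply: (triangular_surjective crea_basis_diag crea_basis_above (bound := snd)).
by move=> b; exact: size_le_energy.
Qed.

End CreationProducts.

(** * Dominance *)

Section Dominance.
Implicit Types (s t u w : seq int) (k : int).

Fixpoint dot w s : int :=
  match w, s with x :: w', k :: s' => x * k + dot w' s' | _, _ => 0 end.

Definition decreasing w : bool := sorted >=%R w.

(** The dominance order, in the form that needs no sorting and is stable under
    inserting a part: the partial sums of [s] are tested by the decreasing
    weights, of which the indicators of initial segments are extreme. *)
Definition dominates s t : Prop := size t = size s /\
  forall w, size w = size s -> decreasing w -> dot w s <= dot w t.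

Definition sdominates s t : Prop := dominates s t /\
  exists w, [/\ size w = size s, decreasing w & dot w s < dot w t].

Lemma dominates_refl s : dominates s s.
Proof. by []. Qed.

Lemma dominates_trans t s u : dominates s t -> dominates t u -> dominates s u.
Proof.
move=> [st dst] [tu dtu]; split=> [|w ws dw]; first by rewrite tu.
by apply: (le_trans (dst w ws dw)); apply: dtu; rewrite // st.
Qed.

Lemma sdominates_dom_trans t s u : sdominates s t -> dominates t u -> sdominates s u.
Proof.
move=> [dst [w [ws dw lt]]] dtu; split; first exact: dominates_trans dtu.
exists w; split=> //; apply: (lt_le_trans lt); apply: dtu.2 => //.
by rewrite dst.1.
Qed.

Lemma decreasing_cons x w : decreasing (x :: w) -> decreasing w.
Proof. by case: w => //= y w /andP[]. Qed.

Lemma decreasing_behead2 x y w : decreasing [:: x, y & w] -> decreasing (x :: w).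
Proof.
case: w => //= z w /and3P[xy yz ->]; rewrite andbT; exact: (le_trans yz xy).
Qed.

Lemma dominates_cons k s t : dominates s t -> dominates (k :: s) (k :: t).
Proof.
move=> [st dst]; split=> [|[|x w] //= [ws] dw]; first by rewrite /= st.
by rewrite lerD2l; apply: dst => //; exact: decreasing_cons dw.
Qed.

Lemma sdominates_cons k s t : sdominates s t -> sdominates (k :: s) (k :: t).
Proof.
move=> [dst [w [ws dw lt]]]; split; first exact: dominates_cons.
(* Repeating the first weight keeps the sequence decreasing. *)
exists (head 0 w :: w); split=> /=; [by rewrite ws|by case: w dw {ws lt} => //= x w ->; rewrite lexx|].
by rewrite ltrD2l.
Qed.

(** Moving [i] units from the second place to the first one. *)
Lemma dominates_insert i x k s y t : 0 <= i -> dominates (x + i :: s) (y :: t) ->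
  dominates [:: x, k & s] [:: y, k - i & t].
Proof.
move=> i0 [[st] dst]; split=> [|[|w0 [|w1 w]] //= [ws] dw]; first by rewrite /= st.
have w01 : w1 <= w0 by case/andP: dw.
have /= := dst (w0 :: w) (congr1 S ws) (decreasing_behead2 dw).
have : 0 <= (w0 - w1) * i by rewrite mulr_ge0 // subr_ge0.
by rewrite !mulrDr mulrBl mulrN; lia.
Qed.

Lemma sdominates_insert i x k s y t : 0 <= i -> sdominates (x + i :: s) (y :: t) ->
  sdominates [:: x, k & s] [:: y, k - i & t].
Proof.
move=> i0 [dst [[|w0 w] [//= [ws] dw lt]]]; split; first exact: dominates_insert.
(* Equal first weights do not see the units that are moved. *)
exists [:: w0, w0 & w]; split=> /=; [by rewrite ws|by rewrite lexx|].
by move: lt; rewrite !mulrDr mulrN; lia.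
Qed.

Lemma sdominates_raise i x k s : 0 < i ->
  sdominates [:: x, k & s] [:: x + i, k - i & s].
Proof.
move=> i0; split.
  by apply: dominates_insert; [exact: ltW|exact: dominates_refl].
have dot0 n t : dot (nseq n 0) t = 0.
  by elim: n t => [|n IHn] [|y t] //=; rewrite mul0r add0r IHn.
have dec0 n : decreasing (nseq n 0).
  by case: n => //= n; elim: n => //= n ->; rewrite lexx.
exists (1 :: nseq (size s).+1 0); split=> /=; first by rewrite size_nseq.
  by have /= -> := dec0 (size s).+1.
by rewrite !mul0r !add0r !dot0 !mul1r; lia.
Qed.

(** Summation of [2 x y <= x^2 + y^2], which is strict if [x != y]. *)
Lemma dot_square_lt s t : size t = size s -> t != s ->
  2 * dot s t < dot t t + dot s s.
Proof.
have le : forall s t, size t = size s -> 2 * dot s t <= dot t t + dot s s.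
  elim=> [|x s1 IHs] [|y t1] //= [/IHs].
  by have := sqr_ge0 (y - x); rewrite sqrrB !expr2; lia.
elim: s t => [|x s IHs] [|y t] //= [st]; rewrite eqseq_cons negb_and.
have := sqr_ge0 (y - x); rewrite sqrrB !expr2.
have [->|yx] := eqVneq y x => /= sq; first by move/(IHs t st); lia.
have := le s t st; have : (y - x) ^+ 2 > 0 by rewrite exprn_even_gt0 //= subr_eq0.
by rewrite sqrrB !expr2; lia.
Qed.

(** The decreasing sequence [s] is itself one of the test weights, so that
    [2 s.s <= 2 s.t < t.t + s.s]. *)
Lemma sdominates_square s t : decreasing s -> sdominates s t ->
  dot s s < dot t t.
Proof.
move=> ds [[st dst] [w [ws dw lt]]].
have ts : t != s by apply/eqP => ts; rewrite ts ltxx in lt.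
by have := dot_square_lt st ts; have := dst s erefl ds; lia.
Qed.

(** Constant weights, of either sign, are decreasing. *)
Lemma dominates_sum s t : dominates s t ->
  \sum_(k <- t) k = \sum_(k <- s) k.
Proof.
move=> [st dst].
have dotc c u : dot (nseq (size u) c) u = c * \sum_(k <- u) k.
  elim: u => [|k u IHu] /=; first by rewrite big_nil mulr0.
  by rewrite IHu big_cons mulrDr.
have dec c n : decreasing (nseq n c).
  by case: n => //= n; elim: n => //= n ->; rewrite lexx.
have := dst (nseq (size s) 1) (size_nseq _ _) (dec _ _).
have := dst (nseq (size s) (-1)) (size_nseq _ _) (dec _ _).
by rewrite !dotc -st !dotc; lia.
Qed.

End Dominance.

(** * Expansion of monomials in products of creation coefficients *)

Section MonomialExpansion.
Context {C : numClosedFieldType}.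
Local Notation F := (Fock C).
Implicit Types (m n k : int) (v : F) (s t u : seq int).

Let vertL eps n : linear (@vop C eps n) := @vop_linear C eps n.
Let creaL eps k : linear (@crea C eps k) := @crea_linear C eps k.

Inductive prod_span m (Q : seq int -> Prop) : F -> Prop :=
| prod_span0 : prod_span m Q 0
| prod_spanD c t v : Q t -> prod_span m Q v ->
    prod_span m Q (c *: crea_prod m t + v).

Lemma prod_span_add m Q v w : prod_span m Q v -> prod_span m Q w ->
  prod_span m Q (v + w).
Proof.
elim=> [|c t v' Qt _ IH] Qw; first by rewrite add0r.
by rewrite -addrA; apply: prod_spanD => //; exact: IH.
Qed.

Lemma prod_span_scale m Q c v : prod_span m Q v -> prod_span m Q (c *: v).
Proof.
elim=> [|c' t v' Qt _ IH]; first by rewrite scaler0; exact: prod_span0.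
by rewrite scalerDr scalerA; apply: prod_spanD.
Qed.

Lemma prod_span_prod m (Q : seq int -> Prop) t : Q t -> prod_span m Q (crea_prod m t).
Proof.
move=> Qt; rewrite -[crea_prod m t]addr0 -[crea_prod m t]scale1r.
by apply: prod_spanD => //; exact: prod_span0.
Qed.

Lemma prod_span_linear m m' (Q Q' : seq int -> Prop) (f : F -> F) v : linear f ->
  (forall t, Q t -> prod_span m' Q' (f (crea_prod m t))) ->
  prod_span m Q v -> prod_span m' Q' (f v).
Proof.
move=> lf fQ; elim=> [|c t w Qt _ IH]; first by rewrite (linfun0 lf); exact: prod_span0.
by rewrite lf; apply: prod_span_add => //; apply: prod_span_scale; exact: fQ.
Qed.

Lemma prod_span_sub m (Q Q' : seq int -> Prop) v : (forall t, Q t -> Q' t) ->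
  prod_span m Q v -> prod_span m Q' v.
Proof.
move=> QQ'; elim=> [|c t w Qt _ IH]; first exact: prod_span0.
by apply: prod_spanD => //; exact: QQ'.
Qed.

Lemma crea_prod_cons m k s : crea_prod m (k :: s) = crea 1 k (crea_prod m s) :> F.
Proof. by []. Qed.

(** Each passage of [e_n] through an old part, by [vop_crea], moves 0, 1 or 2 units
    from that part to the new one. *)
Lemma vop_crea_prod n m s :
  prod_span (m + 1) (sdominates (- n - 1 - 2 * m :: s))
    (vop 1 n (crea_prod m s) - crea_prod (m + 1) (- n - 1 - 2 * m :: s)).
Proof.
elim: s n => [|k s IHs] n.
  rewrite crea_prod_cons /crea_prod /= vop_ket mulr1 subrr; exact: prod_span0.
pose x := - n - 1 - 2 * m.
have step i : 0 <= i -> prod_span (m + 1) (sdominates [:: x, k & s])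
    (crea 1 (k - i) (vop 1 (n - i) (crea_prod m s))
       - crea_prod (m + 1) [:: x + i, k - i & s]).
  move=> i0; have := IHs (n - i).
  have -> : - (n - i) - 1 - 2 * m = x + i by rewrite /x; ring.
  rewrite !crea_prod_cons (creaC 1 (x + i) 1 (k - i)) -(linfunB (creaL 1 _)).
  apply: prod_span_linear; first exact: creaL.
  case=> [|y t] dt; first by have [[]] := dt.
  rewrite crea_prod_cons creaC -!crea_prod_cons.
  by apply: prod_span_prod; exact: sdominates_insert.
rewrite crea_prod_cons vop_crea -/x.
have raise i : 0 < i -> prod_span (m + 1) (sdominates [:: x, k & s])
    (crea 1 (k - i) (vop 1 (n - i) (crea_prod m s))).
  move=> i0; rewrite -[crea _ _ _](subrK (crea_prod (m + 1) [:: x + i, k - i & s])).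
  apply: prod_span_add; first by apply: step; exact: ltW.
  by apply: prod_span_prod; exact: sdominates_raise.
have regroup (a b d p : F) : a - b + d - p = (a - p) + (- b + d).
  by rewrite -!addrA; congr (a + _); rewrite addrA addrC.
rewrite regroup; apply: prod_span_add.
  by have := step 0 (lexx _); rewrite !subr0 ?addr0.
apply: prod_span_add; last exact: raise.
by rewrite -scaleNr; apply: prod_span_scale; exact: raise.
Qed.

(** The product [e_(i_1) ... e_(i_N) |j sqrt2>]; a part [k] applied in charge [m]
    stands for the mode [- k - 1 - 2 m], so that zero parts map vacua to vacua
    and the energy above the vacuum grows by [k] at the leading term. *)
Fixpoint monomial_of_parts (j : int) s : F :=
  if s is k :: s' then
    vop 1 (- k - 1 - 2 * (j + (size s')%:Z)) (monomial_of_parts j s')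
  else ket j.

Lemma monomial_of_partsP j s :
  prod_span (j + (size s)%:Z) (sdominates s)
    (monomial_of_parts j s - crea_prod (j + (size s)%:Z) s).
Proof.
elim: s => [|k s IHs].
  by rewrite addr0 /crea_prod /= subrr; exact: prod_span0.
rewrite [monomial_of_parts _ _]/= [size _]/= -addn1 PoszD addrA.
move: (monomial_of_parts j s) (j + (size s)%:Z) IHs => v m IHs.
set n := - k - 1 - 2 * m.
have nk : - n - 1 - 2 * m = k by rewrite /n; ring.
rewrite -[v](subrK (crea_prod m s)) (linfunD (vertL 1 n)) -[X in prod_span _ _ X]addrA.
apply: prod_span_add; last by have := vop_crea_prod n m s; rewrite nk.
apply: prod_span_linear IHs => // t st.
rewrite -[vop _ _ _](subrK (crea_prod (m + 1) (k :: t))).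
have kst := sdominates_cons k st.
apply: prod_span_add; last exact: prod_span_prod.
have := vop_crea_prod n m t; rewrite nk; apply: prod_span_sub => u ktu.
by apply: (sdominates_dom_trans kst); case: ktu.
Qed.

End MonomialExpansion.

(** * Admissible sequences and partitions *)

Section Partitions.
Local Open Scope mset_scope.
Implicit Types (mu : {mset nat}) (s t : seq int) (b : fock_index).

Definition parts mu : seq int := sort >=%R [seq p.+1%:Z | p <- enum_mset mu].

Definition mset_of_parts s : {mset nat} :=
  seq_mset [seq `|k|%N.-1 | k <- s & 0 < k].

Definition sum_squares mu : nat := \sum_(p <- enum_mset mu) p.+1 ^ 2.

Lemma perm_parts mu : perm_eq (parts mu) [seq p.+1%:Z | p <- enum_mset mu].
Proof. by rewrite perm_sort. Qed.

Lemma parts_decreasing mu : decreasing (parts mu).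
Proof. by apply: sort_sorted => x y; exact: le_total. Qed.

Lemma parts_gt0 mu : all (fun k => 0 < k) (parts mu).
Proof. by rewrite (perm_all _ (perm_parts mu)) all_map; apply/allP. Qed.

Lemma parts_ge0 mu : all (>= 0) (parts mu).
Proof. by apply: sub_all (parts_gt0 mu) => k; exact: ltW. Qed.

Lemma parts_mset_of s : all (>= 0) s ->
  perm_eq [seq p.+1%:Z | p <- enum_mset (mset_of_parts s)] [seq k <- s | 0 < k].
Proof.
move=> s0; rewrite (perm_trans (perm_map _ (perm_eq_seq_mset _))) //.
rewrite -map_comp (_ : map _ _ = [seq k <- s | 0 < k]) // -[RHS]map_id.
by apply/eq_in_map => k; rewrite mem_filter => /andP[k0 _] /=; lia.
Qed.

Lemma mset_of_partsK mu : mset_of_parts (parts mu) = mu.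
Proof.
rewrite /mset_of_parts (all_filterP (parts_gt0 mu)) -[RHS]seq_mset_id.
apply/eq_seq_msetP; rewrite (perm_trans (perm_map _ (perm_parts mu))) //.
by rewrite -map_comp map_id_in.
Qed.

Lemma big_mset_of_parts (h : int -> int) s : h 0 = 0 -> all (>= 0) s ->
  \sum_(p <- enum_mset (mset_of_parts s)) h p.+1%:Z = \sum_(k <- s) h k.
Proof.
move=> h0 s0; rewrite -(big_map (fun p : nat => p.+1%:Z) predT h).
rewrite (perm_big _ (parts_mset_of s0)) big_filter big_mkcond.
rewrite big_seq [RHS]big_seq; apply: eq_bigr => k ks.
case: ltP => // k0; have := allP s0 k ks => /= k0'.
by have -> : k = 0 by lia.
Qed.

Lemma energy_mset_of_parts s : all (>= 0) s ->
  (energy (mset_of_parts s))%:Z = \sum_(k <- s) k.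
Proof.
move=> s0; rewrite -(big_mset_of_parts (h := id)) //.
by rewrite /energy (big_morph Posz PoszD (erefl _)).
Qed.

Lemma sum_squares_mset_of_parts s : all (>= 0) s ->
  (sum_squares (mset_of_parts s))%:Z = dot s s.
Proof.
move=> s0; have -> : dot s s = \sum_(k <- s) k * k.
  by elim: (s) => [|k t IHt] /=; rewrite ?big_nil // big_cons IHt.
rewrite -(big_mset_of_parts (h := fun k => k * k)) ?mul0r //.
by rewrite /sum_squares (big_morph Posz PoszD (erefl _)).
Qed.

Lemma sum_squares_le mu : (sum_squares mu <= energy mu ^ 2)%N.
Proof.
rewrite /sum_squares /energy; elim: (enum_mset mu) => [|p s IHs].
  by rewrite !big_nil.
by rewrite !big_cons sqrnD; lia.
Qed.

(** With [lambda = 0] this is the sequence of [|m sqrt2>], [m] being the charge;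
    positions are counted from 0, which turns [2 k - 1] into [2 k + 1]. *)
Definition index_seq b (k : nat) : int :=
  - 2 * b.1 + (2 * k)%:Z + 1 - nth 0 (parts b.2) k.

Lemma nth_parts_step mu k : nth 0 (parts mu) k.+1 <= nth 0 (parts mu) k.
Proof.
have [kl|kl] := ltnP k.+1 (size (parts mu)); last first.
  rewrite [X in X <= _]nth_default //; have [kl'|kl'] := ltnP k (size (parts mu)).
    exact: (allP (parts_ge0 mu) _ (mem_nth 0 kl')).
  by rewrite nth_default.
by have /(sortedP 0) h := parts_decreasing mu; exact: h.
Qed.

Lemma index_seq_tail b : has_tail (index_seq b) (size (parts b.2))
  (b.1 - (size (parts b.2))%:Z).
Proof.
move=> r; rewrite /index_seq nth_default ?leq_addr //; lia.
Qed.

Lemma index_seq_admissible b : admissible (index_seq b).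
Proof.
have step k : 2 <= index_seq b k.+1 - index_seq b k.
  by have := nth_parts_step b.2 k; rewrite /index_seq; lia.
split=> // [k||].
- by have := step k; lia.
- exists (size (parts b.2)) => k sk; rewrite /index_seq nth_default // subr0.
  have -> : - 2 * b.1 + (2 * k)%:Z + 1 = (k%:Z - b.1) * 2 + 1 by lia.
  by rewrite modzMDl.
- exists (size (parts b.2)) => k sk.
  by rewrite /index_seq !nth_default ?(leq_trans sk) //; lia.
Qed.

(** In a decreasing sequence of nonnegative integers the zeros come last. *)
Lemma nth_filter_gt0 s k : decreasing s -> all (>= 0) s ->
  nth 0 [seq x <- s | 0 < x] k = nth 0 s k.
Proof.
elim: s k => //= x s IHs k ds /andP[x0 s0].
case: ltP => x0'; first by case: k => //= k; rewrite IHs //; exact: decreasing_cons ds.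
have xE : x = 0 by lia.
have s00 y : y \in s -> y = 0.
  move=> ys; have := allP (order_path_min (rev_trans le_trans) ds) y ys.
  by have := allP s0 y ys; rewrite /= xE; lia.
have -> : [seq x <- s | 0 < x] = [::].
  rewrite -(filter_pred0 s); apply: eq_in_filter => y /s00 ->.
  by rewrite ltxx.
rewrite nth_nil xE; case: k => //= k; have [ks|ks] := ltnP k (size s).
  by rewrite (s00 _ (mem_nth 0 ks)).
by rewrite nth_default.
Qed.

(** The gaps of at least 2 make [lam] decreasing, and the charge [m] is chosen
    so that it vanishes from some position on. *)
Lemma index_seq_surj (i : nat -> int) : admissible i ->
  exists b, i = index_seq b.
Proof.
move=> [_ gap [M1 odd] [M2 two]]; pose M := maxn M1 M2.
have [a iM] : exists a : int, i M = 2 * a + 1.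
  have := odd M (leq_maxl _ _) => h; exists (i M %/ 2)%Z.
  by rewrite {1}(divz_eq (i M) 2) h mulrC.
have iE k : i (M + k)%N = 2 * a + 1 + 2 * k%:Z.
  elim: k => [|k IHk]; first by rewrite addn0 mulr0 addr0.
  by have := two (M + k)%N (leq_trans (leq_maxr _ _) (leq_addr _ _)); rewrite addnS; lia.
pose m : int := M%:Z - a; pose lam k := - 2 * m + (2 * k)%:Z + 1 - i k.
have lam_step k : lam k.+1 <= lam k by have := gap k; rewrite /lam; lia.
have lam0 k : lam (M + k)%N = 0 by rewrite /lam iE /m; lia.
have lam_ge0 k : 0 <= lam k.
  have [Mk|kM] := leqP M k; first by rewrite -(subnKC Mk) lam0.
  rewrite -(lam0 0%N) addn0 -(subnKC (ltnW kM)).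
  elim: (M - k)%N => [|d IHd]; first by rewrite addn0.
  by rewrite addnS; exact: le_trans (lam_step _) IHd.
pose s := mkseq lam M.
have ds : decreasing s.
  by apply/(sortedP 0) => k; rewrite size_mkseq => kM; rewrite !nth_mkseq ?(ltnW kM) //;
    exact: lam_step.
have s0 : all (>= 0) s by apply/allP => _ /mapP[k _ ->]; exact: lam_ge0.
have partsE : parts (mset_of_parts s) = [seq x <- s | 0 < x].
  apply: (sorted_eq (rev_trans le_trans)).
  - by move=> x y /andP[xy yx]; apply/eqP; rewrite eq_le xy yx.
  - exact: parts_decreasing.
  - by apply: sorted_filter => //; exact: (rev_trans le_trans).
  - by rewrite (perm_trans (perm_parts _)) // parts_mset_of.
exists (m, mset_of_parts s); apply: funext => k.
rewrite /index_seq /= partsE nth_filter_gt0 //.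
have -> : nth 0 s k = lam k.
  have [kM|Mk] := ltnP k M; first by rewrite nth_mkseq.
  by rewrite nth_default ?size_mkseq // -(subnKC Mk) lam0.
by rewrite /lam; lia.
Qed.

End Partitions.

(** * The basis of semi-infinite monomials *)

Section MonomialBasis.
Context {C : numClosedFieldType}.
Local Notation F := (Fock C).
Implicit Types (b : fock_index) (v : F) (s t : seq int).

Definition monomial_basis b : F :=
  monomial_of_parts (b.1 - (size (parts b.2))%:Z) (parts b.2).

Lemma monomial_of_partsE (i : nat -> int) N j s :
  (forall k, (k < size s)%N ->
     i (N + k)%N = - nth 0 s k - 1 - 2 * (j + (size s - k.+1)%N%:Z)) ->
  foldr (fun k w => act_e fock_ops (i k) w) (ket j) (iota N (size s))
    = monomial_of_parts j s :> F.
Proof.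
elim: s N => [//|x s IHs] N iE; have := iE 0%N isT.
rewrite addn0 [nth _ _ _]/= [size _]/= subSS subn0 => iN.
transitivity (act_e (@fock_ops C) (i N)
  (foldr (fun k w => act_e fock_ops (i k) w) (ket j) (iota N.+1 (size s)))).
  by [].
rewrite act_eE iN IHs // => k ks.
by rewrite addSnnS iE.
Qed.

Lemma index_seq_monomial b :
  semi_infinite_monomial C (index_seq b) = monomial_basis b.
Proof.
rewrite (semi_infinite_monomialE (index_seq_tail b)).
apply: monomial_of_partsE => k ks; rewrite add0n /index_seq; lia.
Qed.

Lemma crea_prod_basis m t : all (>= 0) t ->
  crea_prod m t = crea_basis (m, mset_of_parts t) :> F.
Proof.
move=> t0; rewrite crea_prod_filter //; apply: crea_prod_perm.
by rewrite perm_sym parts_mset_of.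
Qed.

(** A strictly dominating sequence has the same energy and a larger sum of
    squares. *)
Lemma monomial_basis_expand b : exists x : F,
  monomial_basis b = linear_extension crea_basis (fock_basis b + x) /\
  supp_in (fun a => (a.1, energy a.2) = (b.1, energy b.2) /\
     (sum_squares b.2 < sum_squares a.2)%N) x.
Proof.
case: b => m mu; rewrite /monomial_basis; set s := parts mu.
have lL := @linear_extension_linear C crea_basis.
set S := (X in supp_in X).
have := @monomial_of_partsP C (m - (size s)%:Z) s; rewrite subrK /=.
have sE : crea_prod m s = linear_extension crea_basis (fock_basis (m, mu)) :> F.
  rewrite linear_extension_basis crea_prod_basis ?mset_of_partsK //.
  exact: parts_ge0.
suff span v : prod_span m (sdominates s) v ->
    exists2 x : F, v = linear_extension crea_basis x & supp_in S x.
  move=> /span[x vx Sx]; exists x; split=> //.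
  by rewrite (linfunD lL) -vx -sE [RHS]addrC subrK.
elim=> [|c t w st _ [x -> Sx]].
  by exists 0; [rewrite (linfun0 lL)|exact: supp_in0].
have [t0|/crea_prod_lt0 ->] := boolP (all (>= 0) t); last first.
  by exists x => //; rewrite scaler0 add0r.
exists (c *: fock_basis (m, mset_of_parts t) + x).
  by rewrite lL linear_extension_basis crea_prod_basis.
apply: supp_inD => //; apply: supp_inZ; apply: supp_in_basis; rewrite /S /=.
have s0 := parts_ge0 mu; rewrite -/s in s0.
have := dominates_sum st.1.
rewrite -!energy_mset_of_parts // mset_of_partsK => -[->]; split=> //.
have := sdominates_square (parts_decreasing mu) st.
rewrite -!sum_squares_mset_of_parts // mset_of_partsK; lia.
Qed.

(** The monomials are unitriangular over the [crea_basis], itself triangular over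
    the standard basis. *)
Lemma monomial_basis_bijective :
  (forall v, linear_extension monomial_basis v = 0 -> v = 0) /\
  (forall v, exists x, linear_extension monomial_basis x = v).
Proof.
have [x xP] := choice monomial_basis_expand.
pose u b : F := fock_basis b + x b.
have u_diag b : mcoeff b (u b) != 0.
  rewrite mcoeffD mcoeff_basis eqxx.
  have [->|xb] := eqVneq (mcoeff b (x b)) 0; first by rewrite addr0 oner_eq0.
  by have [_] := (xP b).2 b xb; rewrite ltnn.
have u_above b a : mcoeff a (u b) != 0 -> a = b \/
    ((a.1, energy a.2) = (b.1, energy b.2) /\ (sum_squares b.2 < sum_squares a.2)%N).
  rewrite mcoeffD mcoeff_basis; have [->|ba] := eqVneq b a; first by left.
  by rewrite add0r => xa; right; exact: ((xP b).2 a xa).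
have LE v : linear_extension monomial_basis v
    = linear_extension crea_basis (linear_extension u v).
  have lL := @linear_extension_linear C.
  apply: (eq_on_basis (lL _) (linear_comp (lL _) (lL _))) => b /=.
  by rewrite !linear_extension_basis (xP b).1.
split=> v.
  by rewrite LE => /crea_basis_injective/(triangular_injective u_diag u_above).
have [w <-] := crea_basis_surjective v.
have bnd b : (sum_squares b.2 <= (energy b.2) ^ 2)%N by exact: sum_squares_le.
have [y <-] := triangular_surjective u_diag u_above
  (bound := fun g => (g.2 ^ 2)%N) bnd w.
by exists y; rewrite LE.
Qed.

Lemma semi_infinite_monomial_basis :
  is_basis admissible (semi_infinite_monomial C).
Proof.
have [inj surj] := monomial_basis_bijective.
have lL := @linear_extension_linear C monomial_basis.
split=> [n i c i_inj adm|v].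
  have [b iE] := choice (fun k => index_seq_surj (adm k)).
  move=> sum0; have := inj (\sum_k c k *: fock_basis (b k)).
  rewrite (linfun_sum _ _ _ lL) -[X in X = 0 -> _](_ : \sum_k c k *: semi_infinite_monomial C (i k) = _).
    move=> /(_ sum0) z k; have := congr1 (mcoeff (b k)) z.
    rewrite mcoeff0 mcoeff_sum (bigD1 k) //= big1 => [|k' kk'].
      by rewrite addr0 mcoeffZ mcoeff_basis eqxx mulr1.
    rewrite mcoeffZ mcoeff_basis; case: eqP => [bb|_]; last by rewrite mulr0.
    by move/eqP: kk'; case; apply: i_inj; rewrite !iE bb.
  apply: eq_bigr => k _; rewrite (linfunZ _ lL) linear_extension_basis.
  by rewrite iE index_seq_monomial.
have [x <-] := surj v; pose r := enum_fset (msupp x).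
exists (size r), (fun k => index_seq (tnth (in_tuple r) k)),
  (fun k => mcoeff (tnth (in_tuple r) k) x).
split=> [k|]; first exact: index_seq_admissible.
rewrite /linear_extension (big_tnth _ _ r) /=.
by apply: eq_bigr => k _; rewrite index_seq_monomial.
Qed.

End MonomialBasis.

Theorem mainTheorem1 (R : realType) :
  [/\ is_L (@fock_ops R[i]) 0 1 (ket 0),
      forall (i : nat -> int) (N : nat) (j : int),
        admissible i -> has_tail i N j ->
        semi_infinite_monomial R[i] i = finite_monomial i N (ket j)
    & is_basis admissible (semi_infinite_monomial R[i])].
Proof.
split.
- exact: fock_is_L01.
- by move=> i N j _; exact: semi_infinite_monomialE.
- exact: semi_infinite_monomial_basis.
Qed.
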